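(* Let $R\subseteq S$ be an étale ring extension, where $R$ is a FMIR. (1) $S$ is a FMIR, and for $Q\in\mathrm{Spec}(S)$ and $P:=Q\cap R$, $S_Q$ is a field (respectively, a finite ring, an infinite SPIR) if and only if $R_P$ is a field (respectively, a finite ring, an infinite SPIR). (2) If in addition $\mathrm{rk}_{R_P}(S_P)\le 2$ for each prime ideal $P\in\mathrm{Supp}_R(S/R)$ such that $R_P$ is an infinite SPIR, then $R\subseteq S$ has FIP.
   Context: Rings are commutative with identity. Étale: flat, of finite presentation and unramified. A FMIR is a ring with only finitely many ideals (equivalently a finite product of finite local rings, infinite SPIRs and fields). A SPIR is a local ring, not a field, whose maximal ideal is principal and nilpotent. $\mathrm{rk}_{R_P}(S_P)$ is the rank of $S_P$ as a free $R_P$-module. $\mathrm{Supp}_R(S/R)$ is the set of primes $P$ of $R$ with $(S/R)_P\neq0$. FIP: finitely many $R$-subalgebras of $S$. *)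

(* Defs.v *)
From Stdlib Require List.
From HB Require Import structures.
From mathcomp Require Import all_boot all_order all_algebra.
From mathcomp Require Import mpoly.
Set Implicit Arguments. Unset Strict Implicit. Unset Printing Implicit Defensive.
Import GRing.Theory.
Local Open Scope ring_scope.

Section IdealDefs.
Variable A : comNzRingType.

Definition is_ideal (I : A -> Prop) : Prop :=
  I 0 /\ (forall x y, I x -> I y -> I (x + y)) /\ (forall a x, I x -> I (a * x)).

Definition is_prime (P : A -> Prop) : Prop :=
  is_ideal P /\ ~ P 1 /\ (forall x y, P (x * y) -> P x \/ P y).

Definition FMIR : Prop :=
  exists l : seq (A -> Prop), forall I, is_ideal I ->
    exists2 J, List.In J l & forall x, I x <-> J x.

(* U is a multiplicative subset given as a predicate; a fraction a/s is the pair (a, s)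
   with U s; two fractions are equal iff u (a t - b s) = 0 for some u in U. *)
Definition loc_eq (U : A -> Prop) (x y : A * A) : Prop :=
  exists2 u, U u & u * (x.1 * y.2 - y.1 * x.2) = 0.
Definition loc_mul (x y : A * A) : A * A := (x.1 * y.1, x.2 * y.2).
Definition loc_add (x y : A * A) : A * A := (x.1 * y.2 + y.1 * x.2, x.2 * y.2).
Definition loc_zero : A * A := (0, 1).
Definition loc_one : A * A := (1, 1).

Definition loc_field (U : A -> Prop) : Prop :=
  ~ loc_eq U loc_one loc_zero /\
  forall x, U x.2 -> ~ loc_eq U x loc_zero ->
    exists2 y, U y.2 & loc_eq U (loc_mul x y) loc_one.

Definition loc_finite (U : A -> Prop) : Prop :=
  exists l : seq (A * A), (forall z, List.In z l -> U z.2) /\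
    forall x, U x.2 -> exists2 z, List.In z l & loc_eq U x z.

Definition compl (P : A -> Prop) : A -> Prop := fun s => ~ P s.

(* A_P is a SPIR: a local ring (automatic), not a field, whose maximal ideal
   P A_P = { a/s | a in P } is principal, generated by g, and nilpotent. *)
Definition loc_SPIR (P : A -> Prop) : Prop :=
  ~ loc_field (compl P) /\
  exists g : A * A, [/\ ~ P g.2, P g.1,
    (forall x, ~ P x.2 -> P x.1 ->
       exists2 y, ~ P y.2 & loc_eq (compl P) x (loc_mul g y)) &
    exists n : nat, loc_eq (compl P) (g.1 ^+ n, g.2 ^+ n) loc_zero].

Definition loc_infSPIR (P : A -> Prop) : Prop :=
  loc_SPIR P /\ ~ loc_finite (compl P).

End IdealDefs.

Section ExtDefs.
Variables (R S : comNzRingType) (f : {rmorphism R -> S}).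

(* Flatness of S over R, via the equational criterion of flatness *)
Definition flat_alg : Prop :=
  forall (n : nat) (r : 'I_n -> R) (x : 'I_n -> S),
    \sum_(i < n) f (r i) * x i = 0 ->
    exists (m : nat) (a : 'I_n -> 'I_m -> R) (y : 'I_m -> S),
      (forall i, x i = \sum_(j < m) f (a i j) * y j) /\
      (forall j, \sum_(i < n) r i * a i j = 0).

Definition fin_pres : Prop :=
  exists (n : nat) (h : 'I_n -> S) (k : nat) (g : 'I_k -> {mpoly R[n]}),
    (forall s : S, exists p : {mpoly R[n]}, mmap f h p = s) /\
    (forall p : {mpoly R[n]}, mmap f h p = 0 <->
       exists c : 'I_k -> {mpoly R[n]}, p = \sum_(j < k) c j * g j).

Definition is_Rderivation (M : lmodType S) (D : S -> M) : Prop :=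
  (forall a b, D (a + b) = D a + D b) /\
  (forall a b, D (a * b) = a *: D b + b *: D a) /\
  (forall r, D (f r) = 0).

(* Unramified (for an algebra of finite type): Omega_{S/R} = 0, i.e.
   Der_R(S, M) = Hom_S(Omega_{S/R}, M) = 0 for every S-module M. *)
Definition unramified : Prop :=
  forall (M : lmodType S) (D : S -> M), is_Rderivation D -> forall s, D s = 0.

Definition etale : Prop := [/\ flat_alg, fin_pres & unramified].

(* P in Supp_R(S/R): (S/R)_P <> 0, i.e. some class s + R in S/R has s/1 <> 0 in (S/R)_P *)
Definition in_Supp (P : R -> Prop) : Prop :=
  exists s : S, forall u, ~ P u -> ~ exists r, f u * s = f r.

(* S_P = (R \ P)^{-1} S, a localization of S at the image of R \ P *)
Definition imgU (P : R -> Prop) : S -> Prop := fun s => exists2 u, ~ P u & s = f u.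

Definition loc_scal (c : R * R) (x : S * S) : S * S := (f c.1 * x.1, f c.2 * x.2).

Definition free_rank_le2 (P : R -> Prop) : Prop :=
  exists (n : nat) (b : 'I_n -> S * S), [/\ (n <= 2)%N,
    (forall i, imgU P (b i).2),
    (forall x : S * S, imgU P x.2 ->
       exists c : 'I_n -> R * R, (forall i, ~ P (c i).2) /\
         loc_eq (imgU P) x (\big[@loc_add S/loc_zero S]_(i < n) loc_scal (c i) (b i))) &
    (forall c : 'I_n -> R * R, (forall i, ~ P (c i).2) ->
       loc_eq (imgU P) (\big[@loc_add S/loc_zero S]_(i < n) loc_scal (c i) (b i)) (loc_zero S) ->
       forall i, loc_eq (compl P) (c i) (loc_zero R))].

Definition is_subalg (T : S -> Prop) : Prop :=
  (forall r, T (f r)) /\ (forall x y, T x -> T y -> T (x + y)) /\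
  (forall x, T x -> T (- x)) /\ (forall x y, T x -> T y -> T (x * y)).

Definition FIP : Prop :=
  exists l : seq (S -> Prop), forall T, is_subalg T ->
    exists2 T', List.In T' l & forall x, T x <-> T' x.

End ExtDefs.

(* Main.v *)
Require Import Defs.
From Stdlib Require List.
From HB Require Import structures.
From mathcomp Require Import all_boot all_order all_algebra.
From mathcomp Require Import ring ring_quotient ssrcomplements mpoly.
From mathcomp Require boolp classical_sets.

(** Unramifiedness makes the kernel of [S (x)_R S -> S] idempotent, hence [S] is a separable
    [R]-algebra.  Averaging linear projections over the separability element shows that
    separable algebras over semisimple rings are semisimple, so every fibre of [R -> S] is a
    finite product of fields.  Cutting by primitive idempotents of [R] reduces to a local
    base, which is either finite or has a principal nilpotent maximal ideal [(p)]; in the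
    second case every local factor of [S] has the powers of [p] as its only ideals.

    For FIP over a field, a subalgebra [T] is determined by the kernel of
    [S (x)_K S -> S (x)_T S], and [S (x)_K S] is semisimple, so it has finitely many ideals.
    Over a finite base [S] is finite, and over an infinite SPIR the rank condition gives
    [S = R + R x], so that [T = R + I x] for an ideal [I] of [R]. *)

Set Implicit Arguments. Unset Strict Implicit. Unset Printing Implicit Defensive.
Import GRing.Theory.
Local Open Scope ring_scope.

(** Hence [semisimple] only asks each ideal for an element acting on it as identity; this passes
    along separable algebras with no finiteness assumption, and finite generation of the fibres
    comes out afterwards. Zorn's lemma supplies the linear complements. In a FMIR the localization
    at a prime is a factor [eA] with [e] idempotent. Statements on [A_P] thus become equations
    multiplied by [e], and ideals or subalgebras of a factor become those of the whole ring that
    contain the other factor. Flatness gives the injectivity of [R_P -> S_Q], which descends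
    properties from [S_Q] to [R_P]; the ascent rests on [P S_Q = Q S_Q], true because the fibres are
    reduced. An infinite SPIR is not semisimple, so the tensor argument for subalgebras breaks down
    there and the rank bound takes its place. *)

Local Notation asboolP := boolp.asboolP.

(** * Ideals, quotient rings and induced maps *)

Section IdealGen.
Variable A : comNzRingType.
Implicit Types (I J X : A -> Prop).

Lemma is_idealN I x : is_ideal I -> I x -> I (- x).
Proof. by case=> _ [_ IM] Ix; rewrite -mulN1r; apply: IM. Qed.

Lemma is_idealB I x y : is_ideal I -> I x -> I y -> I (x - y).
Proof. by move=> Ii Ix Iy; case: (Ii) => _ [ID _]; apply: ID => //; apply: is_idealN. Qed.

Lemma is_idealMr I x a : is_ideal I -> I x -> I (x * a).
Proof. by case=> _ [_ IM] Ix; rewrite mulrC; apply: IM. Qed.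

Lemma ideal_sum I (T : Type) (r : seq T) (F : T -> A) :
  is_ideal I -> (forall t, I (F t)) -> I (\sum_(t <- r) F t).
Proof.
by move=> [I0 [ID _]] IF; elim/big_ind: _ => // *; apply: ID.
Qed.

(** Encoded as the intersection of all ideals containing [X], so that membership is an induction
    principle, to be applied to any property that is itself an ideal. *)
Definition ideal_gen X : A -> Prop :=
  fun z => forall I, is_ideal I -> (forall x, X x -> I x) -> I z.

Lemma ideal_gen_ideal X : is_ideal (ideal_gen X).
Proof.
split; first by move=> I [].
split=> [x y Xx Xy I Ii XI|a x Xx I Ii XI]; case: (Ii) => _ [ID IM].
  by apply: ID; [apply: Xx|apply: Xy].
by apply: IM; apply: Xx.
Qed.

Lemma mem_ideal_gen X x : X x -> ideal_gen X x.
Proof. by move=> Xx I _; apply. Qed.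

Lemma principal_ideal a : is_ideal (fun x : A => exists y, x = a * y).
Proof.
split; first by exists 0; rewrite mulr0.
split=> [x y [u ->] [v ->]|b x [u ->]].
  by exists (u + v); rewrite mulrDr.
by exists (b * u); ring.
Qed.

Lemma zero_ideal : is_ideal (fun x : A => x = 0).
Proof. by split=> //; split=> [x y -> ->|a x ->]; rewrite ?addr0 ?mulr0. Qed.

Lemma annihilator_ideal a : is_ideal (fun x : A => a * x = 0).
Proof.
split; first by rewrite mulr0.
split=> [x y ax ay|b x ax]; first by rewrite mulrDr ax ay addr0.
by rewrite mulrCA ax mulr0.
Qed.

End IdealGen.

Lemma preim_ideal (A B : comNzRingType) (f : {rmorphism A -> B}) (J : B -> Prop) :
  is_ideal J -> is_ideal (fun x => J (f x)).
Proof.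
move=> [J0 [JD JM]]; split; first by rewrite rmorph0.
by split=> [x y Jx Jy|a x Jx]; rewrite ?rmorphD ?rmorphM; [apply: JD|apply: JM].
Qed.

Section QuotientRing.
Variables (A : comNzRingType) (I : A -> Prop) (Ii : is_ideal I) (I1 : ~ I 1).

Definition ideal_pred : A -> bool := fun x => boolp.asbool (I x).

Lemma ideal_pred_closed : idealr_closed ideal_pred.
Proof.
case: (Ii) => I0 [ID IM]; split; first exact/asboolP.
  by apply/negP => /asboolP.
by move=> a x y /asboolP Ix /asboolP Iy; apply/asboolP/ID => //; apply: IM.
Qed.

Definition classical_idealr : idealr A :=
  HB.pack ideal_pred (isIdealr.Build A ideal_pred ideal_pred_closed).

Lemma quotient_ring : exists (B : comNzRingType) (pi : {rmorphism A -> B}),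
  (forall b, exists a, pi a = b) /\ (forall a, pi a = 0 <-> I a).
Proof.
exists {ideal_quot classical_idealr}, (\pi_({ideal_quot classical_idealr})%qT); split.
  by move=> b; exists (repr b); rewrite /= reprK.
move=> a; split.
  rewrite -(rmorph0 (\pi_({ideal_quot classical_idealr})%qT)) => /eqP.
  by rewrite -Quotient.idealrBE subr0 => /asboolP.
move=> Ia; rewrite -(rmorph0 (\pi_({ideal_quot classical_idealr})%qT)).
by apply/eqP; rewrite -Quotient.idealrBE subr0; apply/asboolP.
Qed.

End QuotientRing.

Lemma quotient_map (R S R' S' : comNzRingType) (f : {rmorphism R -> S})
    (p : {rmorphism R -> R'}) (q : {rmorphism S -> S'}) :
  (forall y, exists x, p x = y) -> (forall x, p x = 0 -> q (f x) = 0) ->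
  exists f' : {rmorphism R' -> S'}, forall x, f' (p x) = q (f x).
Proof.
move=> /boolp.choice [s sK] pq.
have E x : q (f (s (p x))) = q (f x).
  by apply/eqP; rewrite -subr_eq0 -!rmorphB; apply/eqP/pq; rewrite rmorphB sK subrr.
pose g y := q (f (s y)).
have gB : zmod_morphism g.
  by move=> x y; rewrite /g -[in LHS](sK x) -[in LHS](sK y) -rmorphB E !rmorphB.
have gM : monoid_morphism g.
  split; first by rewrite /g -(rmorph1 p) E !rmorph1.
  by move=> x y; rewrite /g -[in LHS](sK x) -[in LHS](sK y) -rmorphM E !rmorphM.
pose m1 := GRing.isZmodMorphism.Build R' S' g gB.
pose m2 := GRing.isMonoidMorphism.Build R' S' g gM.
pose G : {rmorphism R' -> S'} := HB.pack g m1 m2.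
by exists G => x; apply: E.
Qed.

(** * Tensor square and separability *)

Section Separable.
Variables (R S : comNzRingType) (f : {rmorphism R -> S}).

Definition finite_type : Prop :=
  exists (n : nat) (h : 'I_n -> S), forall s, exists p : {mpoly R[n]}, mmap f h p = s.

Definition balanced (V : zmodType) (beta : S -> S -> V) : Prop :=
  [/\ forall x x' y, beta (x + x') y = beta x y + beta x' y,
      forall x y y', beta x (y + y') = beta x y + beta x y' &
      forall r x y, beta (f r * x) y = beta x (f r * y)].

(* [w] represents a separability element of [S] over [R], the identities
   in the tensor square being tested against all balanced maps. *)
Definition separable : Prop := exists w : seq (S * S),
  \sum_(z <- w) z.1 * z.2 = 1 /\
  forall (V : zmodType) (beta : S -> S -> V), balanced beta -> forall s,
    \sum_(z <- w) beta (s * z.1) z.2 = \sum_(z <- w) beta z.1 (s * z.2).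

End Separable.

Section BalancedMap.
Variables (R S : comNzRingType) (f : {rmorphism R -> S}) (n : nat) (h : 'I_n -> S).
Variables (V : zmodType) (beta : S -> S -> V).
Hypothesis bal : balanced f beta.

Let betaDl x x' y : beta (x + x') y = beta x y + beta x' y. Proof. by case: bal. Qed.
Let betaDr x y y' : beta x (y + y') = beta x y + beta x y'. Proof. by case: bal. Qed.
Let betaM r x y : beta (f r * x) y = beta x (f r * y). Proof. by case: bal. Qed.

Lemma balanced0l y : beta 0 y = 0.
Proof. by apply: (addrI (beta 0 y)); rewrite -betaDl !addr0. Qed.

Lemma balanced0r x : beta x 0 = 0.
Proof. by apply: (addrI (beta x 0)); rewrite -betaDr !addr0. Qed.

Lemma balancedNl x y : beta (- x) y = - beta x y.
Proof. by apply: (addrI (beta x y)); rewrite -betaDl !subrr balanced0l. Qed.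

(** The lift of [beta] to [S[X] = S (x)_R R[X]], given by [c X^m |-> beta c (h^m)]; it is later
    shown to factor through the tensor square. *)
Definition balanced_eval (p : {mpoly S[n]}) : V :=
  \sum_(m <- msupp p) beta p@_m (mmap1 h m).

Lemma balanced_evalE p i : (msize p <= i)%N ->
  balanced_eval p = \sum_(m : 'X_{1..n < i}) beta p@_m (mmap1 h m).
Proof.
move=> le_pi; rewrite /balanced_eval.
rewrite (big_mksub ('X_{1..n < i} : subFinType _)) ?msupp_uniq //=; first last.
  by move=> x /msize_mdeg_lt /leq_trans; apply.
by rewrite big_rmcond //= => j /memN_msupp_eq0 ->; rewrite balanced0l.
Qed.

Lemma balanced_evalB : zmod_morphism balanced_eval.
Proof.
move=> p q /=; pose i := maxn (msize (p - q)) (maxn (msize p) (msize q)).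
rewrite !(@balanced_evalE _ i) ?leq_maxl ?leq_max ?leqnn ?orbT // -sumrB.
by apply: eq_bigr => m _; rewrite mcoeffB betaDl balancedNl.
Qed.

Definition balanced_additive : {additive {mpoly S[n]} -> V} := HB.pack balanced_eval
  (GRing.isZmodMorphism.Build {mpoly S[n]} V balanced_eval balanced_evalB).

Lemma balanced_evalZX c m : balanced_additive (c *: 'X_[m]) = beta c (mmap1 h m).
Proof.
have [->|nz] := eqVneq c 0; first by rewrite scale0r raddf0 balanced0l.
rewrite /= /balanced_eval (perm_big [:: m]).
  by rewrite big_seq1 mcoeffZ mcoeffX eqxx mulr1.
apply: uniq_perm => // k.
rewrite mcoeff_msupp mcoeffZ mcoeffX inE [k == m]eq_sym.
by case: (m == k); rewrite ?mulr1 ?mulr0 ?eqxx.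
Qed.

Lemma balanced_eval_map c m (q : {mpoly R[n]}) :
  balanced_additive (c *: 'X_[m] * map_mpoly f q) = beta c (mmap1 h m * mmap f h q).
Proof.
elim/mpolyind: q => [|r k q _ _ IH].
  by rewrite !raddf0 !mulr0 raddf0 balanced0r.
have -> : map_mpoly f (r *: 'X_[k] + q) = f r *: 'X_[k] + map_mpoly f q.
  by rewrite raddfD /= map_mpolyZ map_mpolyX.
rewrite mmapD !mulrDr raddfD IH betaDr; congr (_ + _).
rewrite -scalerAr -scalerAl scalerA -mpolyXD balanced_evalZX.
by rewrite betaM mmapZ mmapX mulrCA -commr_mmap1_M // => i x; apply: mulrC.
Qed.

(** Relations over [R] generate the ideal to be factored out, so vanishing on their multiples is
    what makes the map descend. *)
Lemma balanced_eval_mul_map (c : {mpoly S[n]}) (q : {mpoly R[n]}) :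
  mmap f h q = 0 -> balanced_additive (c * map_mpoly f q) = 0.
Proof.
move=> q0; elim/mpolyind: c => [|c m p _ _ IH]; first by rewrite mul0r raddf0.
by rewrite mulrDl raddfD IH balanced_eval_map q0 mulr0 balanced0r addr0.
Qed.

End BalancedMap.

Lemma meval_map (R S : comNzRingType) (f : {rmorphism R -> S}) n (h : 'I_n -> S)
    (q : {mpoly R[n]}) :
  mmap (idfun : {rmorphism S -> S}) h (map_mpoly f q) = mmap f h q.
Proof.
elim/mpolyind: q => [|c m q _ _ IH]; first by rewrite !raddf0.
by rewrite !raddfD /= IH map_mpolyZ map_mpolyX !mmapZ !mmapX.
Qed.

(** Because [a (x) b = ab (x) 1 + (a (x) 1)(1 (x) b - b (x) 1)], whatever multiplication kills is a
    combination of the differences [i2 s - i1 s]. *)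
Lemma kernel_mul (S B : comNzRingType) (i1 i2 : {rmorphism S -> B})
    (mu : {rmorphism B -> S}) (N : B -> Prop) :
  (forall s, mu (i1 s) = s) -> (forall s, mu (i2 s) = s) -> is_ideal N ->
  (forall s, N (i2 s - i1 s)) ->
  forall w : seq (S * S), mu (\sum_(z <- w) i1 z.1 * i2 z.2) = 0 ->
  N (\sum_(z <- w) i1 z.1 * i2 z.2).
Proof.
move=> mu1 mu2 Ni Nd w; rewrite raddf_sum /= => E.
have -> : \sum_(z <- w) i1 z.1 * i2 z.2 = \sum_(z <- w) i1 z.1 * (i2 z.2 - i1 z.2).
  transitivity (\sum_(z <- w) i1 z.1 * i2 z.2 - i1 (\sum_(z <- w) mu (i1 z.1 * i2 z.2))).
    by rewrite E rmorph0 subr0.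
  rewrite raddf_sum -sumrB; apply: eq_bigr => z _ /=.
  by rewrite (rmorphM mu) mu1 mu2 (rmorphM i1) mulrBr.
by apply: ideal_sum => // z; case: Ni => _ [_]; apply.
Qed.

(* The tensor square of [S] over [R] is realised as [S[X]] modulo the polynomial
   relations over [R] satisfied by the generators [h]. *)
Lemma tensor_square (R S : comNzRingType) (f : {rmorphism R -> S}) :
  finite_type f ->
  exists (B : comNzRingType) (i1 i2 : {rmorphism S -> B}) (mu : {rmorphism B -> S}),
  [/\ forall r, i1 (f r) = i2 (f r),
      (forall s, mu (i1 s) = s) /\ (forall s, mu (i2 s) = s),
      forall b, exists w : seq (S * S), b = \sum_(z <- w) i1 z.1 * i2 z.2,
      forall (V : zmodType) (beta : S -> S -> V), balanced f beta ->
        exists phi : {additive B -> V}, forall x y, phi (i1 x * i2 y) = beta x y &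
      exists (n : nat) (x : 'I_n -> B), (forall l, mu (x l) = 0) /\
        forall b, mu b = 0 -> exists c : 'I_n -> B, b = \sum_l c l * x l].
Proof.
case=> n [h /boolp.choice [lift liftK]].
pose G := ideal_gen (fun p : {mpoly S[n]} =>
  exists2 q : {mpoly R[n]}, mmap f h q = 0 & p = map_mpoly f q).
pose ev : {rmorphism {mpoly S[n]} -> S} := mmap (idfun : {rmorphism S -> S}) h.
have evG p : G p -> ev p = 0.
  move=> Gp; apply: (Gp (fun x => ev x = 0)); first exact: preim_ideal (zero_ideal S).
  by move=> x [q q0 ->]; rewrite /ev /= meval_map.
have Gi : is_ideal G by apply: ideal_gen_ideal.
have [|B [pi [pi_surj piE]]] := quotient_ring Gi.
  by move/evG/eqP; rewrite rmorph1 oner_eq0.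
pose i1 : {rmorphism S -> B} := pi \o (@mpolyC n S).
have i2E q q' : mmap f h q = mmap f h q' -> pi (map_mpoly f q) = pi (map_mpoly f q').
  move=> E; apply/eqP; rewrite -subr_eq0 -!rmorphB; apply/eqP/piE.
  by apply: mem_ideal_gen; exists (q - q'); rewrite // raddfB /= E subrr.
(* The second coprojection: write [s] as a polynomial over [R] in the generators and read it in
   [S[X]]; two lifts differ by a relation. *)
pose g s := pi (map_mpoly f (lift s)).
have gE q : g (mmap f h q) = pi (map_mpoly f q) by apply: i2E; rewrite liftK.
have gB : zmod_morphism g.
  by move=> x y; rewrite -(liftK x) -(liftK y) -raddfB !gE !raddfB.
have gM : monoid_morphism g.
  split; first by rewrite -(rmorph1 (mmap f h)) gE !rmorph1.
  by move=> x y; rewrite -(liftK x) -(liftK y) -rmorphM !gE !rmorphM.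
pose i2 : {rmorphism S -> B} := HB.pack g (GRing.isZmodMorphism.Build S B g gB)
  (GRing.isMonoidMorphism.Build S B g gM).
have [mu muE] : exists mu : {rmorphism B -> S}, forall p, mu (pi p) = ev p.
  by apply: (@quotient_map _ _ _ _ idfun pi ev) => // p /piE /evG.
have i2X m : pi 'X_[m] = i2 (mmap1 h m).
  by rewrite -(mmapX h f) /= gE map_mpolyX.
have piZX c m : pi (c *: 'X_[m]) = i1 c * i2 (mmap1 h m).
  by rewrite -mul_mpolyC rmorphM i2X.
have mu1 s : mu (i1 s) = s by rewrite muE /ev /= mmapC.
have mu2 s : mu (i2 s) = s by rewrite muE /ev /= meval_map liftK.
have spanB b : exists w : seq (S * S), b = \sum_(z <- w) i1 z.1 * i2 z.2.
  have [p <-] := pi_surj b; exists [seq (p@_m, mmap1 h m) | m <- msupp p].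
  rewrite big_map [in LHS](mpolyE p) raddf_sum /=.
  by apply: eq_bigr => m _; apply: piZX.
exists B, i1, i2, mu; split=> //.
- by move=> r; rewrite -(mmapC h f r) /= gE map_mpolyC mmapC.
- move=> V beta bal; pose ph := balanced_additive h bal.
  have phG p : G p -> ph p = 0.
    (* The kernel of an additive map need not be an ideal, so the property is strengthened to all
       multiples [c * p]. *)
    move=> Gp; rewrite -(mul1r p); apply: (Gp (fun p => forall c, ph (c * p) = 0)); first split.
    + by move=> c; rewrite mulr0 raddf0.
    + split=> [x y X Y c|a x X c]; first by rewrite mulrDr raddfD X Y addr0.
      by rewrite mulrA.
    + by move=> x [q q0 ->] c; apply: (balanced_eval_mul_map bal).
  have /boolp.choice [s sK] := pi_surj.
  have E p : ph (s (pi p)) = ph p.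
    by apply/eqP; rewrite -subr_eq0 -raddfB; apply/eqP/phG/piE; rewrite rmorphB sK subrr.
  pose k b := ph (s b).
  have kB : zmod_morphism k.
    by move=> x y; rewrite -(sK x) -(sK y) -rmorphB /k !E raddfB.
  pose K : {additive B -> V} := HB.pack k (GRing.isZmodMorphism.Build B V k kB).
  exists K => x y.
  have -> : K (i1 x * i2 y) = ph (x *: 'X_[0] * map_mpoly f (lift y)).
    by rewrite -E rmorphM mpolyX0 alg_mpolyC.
  by rewrite balanced_eval_map mmap11 mul1r liftK.
- pose x l := i2 (h l) - i1 (h l); exists n, x; split.
    by move=> l; rewrite rmorphB mu1 mu2 subrr.
  pose N b := exists c : 'I_n -> B, b = \sum_l c l * x l.
  have Ni : is_ideal N.
    split; first by exists (fun=> 0); rewrite big1 // => l _; rewrite mul0r.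
    split=> [_ _ [c ->] [d ->]|a _ [c ->]].
      exists (fun l => c l + d l); rewrite -big_split.
      by apply: eq_bigr => l _; rewrite mulrDl.
    exists (fun l => a * c l); rewrite mulr_sumr.
    by apply: eq_bigr => l _; rewrite mulrA.
  have [N0 [ND NM]] := Ni.
  have Nx l : N (x l).
    exists (fun l' => (l' == l)%:R); rewrite (bigD1 l) //= eqxx mul1r big1 ?addr0 //.
    by move=> l' /negbTE ->; rewrite mul0r.
  (* The [s] whose difference lies in [N] form an [R]-subalgebra containing the generators [h],
     hence all of [S]. *)
  pose C s := N (i2 s - i1 s).
  have CD s t : C s -> C t -> C (s + t).
    by rewrite /C !rmorphD opprD addrACA; apply: ND.
  have CM s t : C s -> C t -> C (s * t).
    move=> Cs Ct; rewrite /C.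
    have -> : i2 (s * t) - i1 (s * t) = i2 s * (i2 t - i1 t) + i1 t * (i2 s - i1 s).
      by rewrite !rmorphM; ring.
    by apply: ND; apply: NM.
  have Cf r : C (f r).
    rewrite /C; have -> : i2 (f r) = i1 (f r) by rewrite -(mmapC h f r) /= gE map_mpolyC mmapC.
    by rewrite subrr.
  have Cmap s : C s.
    rewrite -(liftK s); elim/mpolyind: (lift s) => [|c m q _ _ IH].
      by rewrite raddf0 /C !rmorph0 subrr.
    rewrite raddfD /=; apply: CD => //; rewrite mmapZ mmapX; apply: (CM) => //.
    have C1 : C 1 by rewrite -(rmorph1 f).
    rewrite /mmap1; apply: (big_ind C) => // l _.
    have Ch : C (h l) by apply: Nx.
    by elim: (m l) => [|k IHk]; rewrite ?expr0 // exprS; apply: CM.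
  by move=> b; have [w ->] := spanB b; apply: (@kernel_mul _ _ i1 i2 mu N).
Qed.

(** A type alias, so that [B] can carry the [S]-module structure through [i] that the target of a
    derivation requires. *)
Definition restrict_scalars (S B : comNzRingType) (i : {rmorphism S -> B}) : Type := B.
HB.instance Definition _ (S B : comNzRingType) (i : {rmorphism S -> B}) :=
  GRing.Zmodule.copy (restrict_scalars i) B.

Section RestrictScalars.
Variables (S B : comNzRingType) (i : {rmorphism S -> B}).

Definition restrict_scale (s : S) (b : restrict_scalars i) : restrict_scalars i :=
  i s * (b : B).

Lemma restrict_scaleA a b v :
  restrict_scale a (restrict_scale b v) = restrict_scale (a * b) v.
Proof. by rewrite /restrict_scale rmorphM mulrA. Qed.

Lemma restrict_scale1 : left_id 1 restrict_scale.
Proof. by move=> v; rewrite /restrict_scale rmorph1 mul1r. Qed.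

Lemma restrict_scaleDr : right_distributive restrict_scale +%R.
Proof. by move=> a u v; rewrite /restrict_scale mulrDr. Qed.

Lemma restrict_scaleDl v : {morph restrict_scale^~ v : a b / a + b}.
Proof. by move=> a b; rewrite /restrict_scale rmorphD mulrDl. Qed.

HB.instance Definition _ := GRing.Zmodule_isLmodule.Build S (restrict_scalars i)
  restrict_scaleA restrict_scale1 restrict_scaleDr restrict_scaleDl.

End RestrictScalars.

Section UnramifiedSeparable.
Variables (R S : comNzRingType) (f : {rmorphism R -> S}).

(* [I = I^2] for the finitely generated kernel [I] of the multiplication, so [I] is
   annihilated by an element [eps] congruent to [1] modulo [I]. *)
Lemma unramified_separable : finite_type f -> unramified f -> separable f.
Proof.
move=> ft unr;
have [B [i1 [i2 [mu [i12 [mu1 mu2] spanB phiB [n [x [mux genx]]]]]]]] := tensor_square ft.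
pose I2 := ideal_gen (fun z : B => exists a b, [/\ mu a = 0, mu b = 0 & z = a * b]).
have I2i : is_ideal I2 by apply: ideal_gen_ideal.
have [|C [pi [_ piE]]] := quotient_ring I2i.
  move=> I21; have := oner_neq0 S; rewrite -(rmorph1 mu) => /eqP; apply.
  apply: (I21 (fun z => mu z = 0)); first exact: preim_ideal (zero_ideal S).
  by move=> _ [a [b [a0 _ ->]]]; rewrite rmorphM a0 mul0r.
pose j : {rmorphism S -> C} := pi \o i1.
(* The universal derivation [s |-> 1 (x) s - s (x) 1]; its vanishing modulo [I^2] puts the
   generators of the kernel [I] into [I^2]. *)
pose D s : restrict_scalars j := pi (i2 s - i1 s).
have Dder : is_Rderivation f D.
  split; first by move=> a b; rewrite /D !rmorphD opprD addrACA rmorphD.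
  split; last by move=> r; rewrite /D i12 subrr rmorph0.
  move=> a b; have -> : a *: D b + b *: D a =
     pi (i1 a * (i2 b - i1 b) + i1 b * (i2 a - i1 a)) by rewrite rmorphD !rmorphM.
  apply/eqP; rewrite -subr_eq0; apply/eqP; rewrite /D -[LHS](rmorphB pi).
  apply/piE; apply: mem_ideal_gen; exists (i2 a - i1 a), (i2 b - i1 b).
  by rewrite !rmorphB !mu1 !mu2 !subrr; split=> //; rewrite !rmorphM; ring.
have I2d s : I2 (i2 s - i1 s) by apply/piE; apply: (unr _ D).
pose N z := exists2 c : 'I_n -> B, (forall l, mu (c l) = 0) & z = \sum_l c l * x l.
have I2N z : I2 z -> N z.
  move=> I2z; apply: (I2z N); first split.
  - by exists (fun=> 0) => [l|]; rewrite ?rmorph0 // big1 // => l _; rewrite mul0r.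
  - split=> [_ _ [c c0 ->] [d d0 ->]|a _ [c c0 ->]].
      exists (fun l => c l + d l) => [l|]; first by rewrite rmorphD c0 d0 addr0.
      by rewrite -big_split; apply: eq_bigr => l _; rewrite mulrDl.
    exists (fun l => a * c l) => [l|]; first by rewrite rmorphM c0 mulr0.
    by rewrite mulr_sumr; apply: eq_bigr => l _; rewrite mulrA.
  - move=> _ [a [b [a0 b0 ->]]]; have [c ->] := genx b b0.
    exists (fun l => a * c l) => [l|]; first by rewrite rmorphM a0 mul0r.
    by rewrite mulr_sumr; apply: eq_bigr => l _; rewrite mulrA.
have I_I2 b : mu b = 0 -> I2 b.
  by have [w ->] := spanB b; apply: (@kernel_mul _ _ i1 i2 mu I2).
have Nx l : N (x l) by apply: I2N; apply: I_I2.
have [c c0 xE] := fin_all_exists2 Nx.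
(* Nakayama by determinants: [M] kills the column [x] and becomes the identity under [mu], so
   [det M] kills the kernel and is sent to [1]. *)
pose M : 'M[B]_n := 1%:M - \matrix_(l, k) c l k.
have Mx : M *m \col_l x l = 0.
  apply/matrixP => l k; rewrite mulmxBl mul1mx !mxE [X in X - _]xE.
  by apply/eqP; rewrite subr_eq0; apply/eqP/eq_bigr => m _; rewrite !mxE.
pose eps := \det M.
have mueps : mu eps = 1.
  rewrite /eps -det_map_mx map_mxB map_mx1 (_ : map_mx mu _ = 0) ?subr0 ?det1 //.
  by apply/matrixP => l k; rewrite !mxE c0.
have epsx l : eps * x l = 0.
  have /matrixP/(_ l 0) : (\adj M *m (M *m \col_l x l)) = 0 by rewrite Mx mulmx0.
  by rewrite mulmxA mul_adj_mx mul_scalar_mx !mxE.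
have epsI b : mu b = 0 -> eps * b = 0.
  move/genx => [d ->]; rewrite mulr_sumr big1 // => l _.
  by rewrite mulrCA epsx mulr0.
have [w epsE] := spanB eps; exists w; split.
  rewrite -mueps epsE raddf_sum; apply: eq_bigr => z _ /=.
  by rewrite rmorphM mu1 mu2.
move=> V beta bal s; have [phi phiE] := phiB V beta bal.
transitivity (phi (i1 s * eps)).
  rewrite epsE mulr_sumr raddf_sum; apply: eq_bigr => z _.
  by rewrite mulrA -rmorphM phiE.
transitivity (phi (i2 s * eps)).
  congr (phi _); apply/eqP; rewrite -subr_eq0 -mulrBl mulrC; apply/eqP/epsI.
  by rewrite rmorphB mu1 mu2 subrr.
rewrite epsE mulr_sumr raddf_sum; apply: eq_bigr => z _.
by rewrite mulrCA -rmorphM phiE.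
Qed.

End UnramifiedSeparable.

Section SeparableTransfer.
Variables (R S : comNzRingType) (f : {rmorphism R -> S}).

Section Quotient.
Variables (R' S' : comNzRingType) (f' : {rmorphism R' -> S'}).
Variables (p : {rmorphism R -> R'}) (q : {rmorphism S -> S'}).
Hypotheses (q_surj : forall y, exists x, q x = y) (pqE : forall r, f' (p r) = q (f r)).

Lemma finite_type_quotient : finite_type f -> finite_type f'.
Proof.
case=> n [h gen]; exists n, (fun i => q (h i)) => s'.
have [s <-] := q_surj s'; have [r <-] := gen s; exists (map_mpoly p r).
elim/mpolyind: r => [|c m r _ _ IH]; first by rewrite !raddf0.
rewrite !raddfD /= IH map_mpolyZ map_mpolyX !mmapZ !mmapX rmorphM pqE.
by rewrite /mmap1 rmorph_prod; congr (_ * _ + _); apply: eq_bigr => l _; rewrite rmorphXn.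
Qed.

Lemma separable_quotient : separable f -> separable f'.
Proof.
case=> w [w1 wE]; exists [seq (q z.1, q z.2) | z <- w]; split.
  rewrite big_map -(rmorph1 q) -w1 raddf_sum /=.
  by apply: eq_bigr => z _; rewrite rmorphM.
move=> V beta [bl br bM] s'; have [s <-] := q_surj s'.
rewrite !big_map /=; have E := wE V (fun x y => beta (q x) (q y)).
etransitivity; [|etransitivity; [apply: (E _ s)|]].
- by apply: eq_bigr => z _; rewrite rmorphM.
- split=> *; first by rewrite rmorphD bl.
    by rewrite rmorphD br.
  by rewrite !rmorphM -pqE bM.
- by apply: eq_bigr => z _; rewrite rmorphM.
Qed.

End Quotient.

(* Base change of the separability element along [f]. *)
Lemma separable_tensor (B : comNzRingType) (i1 i2 : {rmorphism S -> B}) :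
  (forall r, i1 (f r) = i2 (f r)) ->
  (forall b, exists w : seq (S * S), b = \sum_(z <- w) i1 z.1 * i2 z.2) ->
  separable f -> separable i1.
Proof.
move=> i12 spanB [w [w1 wE]]; exists [seq (i2 z.1, i2 z.2) | z <- w]; split.
  rewrite big_map -(rmorph1 i2) -w1 raddf_sum /=.
  by apply: eq_bigr => z _; rewrite rmorphM.
move=> V beta bal b; have [bl br bM] := bal; rewrite !big_map /=.
have [v ->] := spanB b; elim: v => [|[x y] v IH].
  by rewrite !big_nil; apply: eq_bigr => z _; rewrite !mul0r (balanced0l bal) (balanced0r bal).
rewrite big_cons; under eq_bigr do rewrite mulrDl bl.
under [RHS]eq_bigr do rewrite mulrDl br.
rewrite !big_split {}IH; congr (_ + _) => /=.
have := wE V (fun u v => beta (i1 x * i2 u) (i2 v)).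
move=> /(_ _ y) E; etransitivity; [|etransitivity; [apply: E|]].
- by apply: eq_bigr => z _; rewrite rmorphM mulrA.
- split=> [u u' v'|u v' v''|r u v'].
  + by rewrite rmorphD mulrDr bl.
  + by rewrite rmorphD br.
  + by rewrite !rmorphM -!i12 mulrCA (bM (f r)).
- by apply: eq_bigr => z _; rewrite bM rmorphM mulrA.
Qed.

End SeparableTransfer.

(** * Semisimple rings *)

(** The empty family is a chain too, so [P] must hold of the empty set; applications admit it and
    recover nonemptiness from maximality. *)
Lemma zorn_union (T : Type) (P : (T -> Prop) -> Prop) :
  (forall F : (T -> Prop) -> Prop, (forall X, F X -> P X) ->
     (forall X Y, F X -> F Y -> (forall x, X x -> Y x) \/ (forall x, Y x -> X x)) ->
     P (fun x => exists2 X, F X & X x)) ->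
  exists M, P M /\ forall N, P N -> (forall x, M x -> N x) -> forall x, N x -> M x.
Proof.
move=> chainP; have [|M [PM maxM]] := @classical_sets.Zorn_bigcup T P.
  by move=> F FP totF; apply: chainP => // X Y FX FY; apply: totF.
exists M; split=> // N PN MN x Nx; apply: boolp.contrapT => nMx.
by apply: (maxM N) => //; split=> // NM; apply/nMx/NM.
Qed.

(** Taking [x = u] shows that [u] is idempotent and [J = uA]; among commutative rings this
    characterizes finite products of fields. *)
Definition semisimple (A : comNzRingType) : Prop :=
  forall J : A -> Prop, is_ideal J -> exists2 u, J u & forall x, J x -> x = x * u.

Definition semisimple_in (S : comNzRingType) (T : S -> Prop) : Prop :=
  forall J : S -> Prop, (forall x, J x -> T x) -> J 0 ->
    (forall x y, J x -> J y -> J (x + y)) -> (forall t x, T t -> J x -> J (t * x)) ->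
    exists2 u, J u & forall x, J x -> x = x * u.

Section Projection.
Variables (S : comNzRingType) (T W : S -> Prop).
Hypotheses (T1 : T 1) (TN : forall x, T x -> T (- x)).
Hypotheses (TD : forall x y, T x -> T y -> T (x + y)).
Hypotheses (TM : forall x y, T x -> T y -> T (x * y)).
Hypotheses (W0 : W 0) (WD : forall x y, W x -> W y -> W (x + y)).
Hypotheses (WM : forall t x, T t -> W x -> W (t * x)).
Hypothesis Tss : semisimple_in T.

(** Zorn gives a submodule [C] maximal among those meeting [W] in [0]; semisimplicity of [T] forces
    [W + C = S], and [p] projects along [C]. *)
Lemma linear_projection : exists p : S -> S,
  [/\ forall x y, p (x + y) = p x + p y, forall t x, T t -> p (t * x) = t * p x,
      forall x, W (p x) & forall x, W x -> p x = x].
Proof.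
have T0 : T 0 by rewrite -(subrr 1); apply/TD/TN.
pose P C := (forall t x y, T t -> C x -> C y -> C (x + t * y)) /\
            (forall x, C x -> W x -> x = 0 :> S).
have [|C [[CDM CW] maxC]] := @zorn_union S P.
  move=> F FP tot; split=> [t x y Tt [X FX Xx] [Y FY Yy]|x [X FX Xx]]; last first.
    by case: (FP X FX) => _; apply.
  case: (tot X Y FX FY) => [XY|YX].
    by exists Y => //; case: (FP Y FY) => H _; apply: H => //; apply: XY.
  by exists X => //; case: (FP X FX) => H _; apply: H => //; apply: YX.
have [c0 Cc0] : exists c, C c.
  apply: boolp.contrapT => nC; apply: (nC); exists 0; apply: (maxC (fun x => x = 0)) => //.
    by split=> // t x y _ -> ->; rewrite mulr0 addr0.
  by move=> x Cx; case: nC; exists x.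
have C0 : C 0 by rewrite -(subrr c0) -mulN1r; apply: CDM => //; apply: TN.
have CM t x : T t -> C x -> C (t * x) by move=> Tt Cx; rewrite -[_ * _]add0r; apply: CDM.
have CD x y : C x -> C y -> C (x + y) by move=> Cx Cy; rewrite -[y]mul1r; apply: CDM.
have CN x : C x -> C (- x) by move=> Cx; rewrite -mulN1r; apply/CM => //; apply: TN.
have WN x : W x -> W (- x) by move=> Wx; rewrite -mulN1r; apply/WM => //; apply: TN.
have dec s : exists wc, [/\ W wc.1, C wc.2 & s = wc.1 + wc.2].
  (* The conductor of [s] into [W + C], with idempotent generator [u]. Then [s' = (1 - u) s] can be
     added to [C] without meeting [W]: if [t s'] lies in [W + C], then
     [t (1 - u) = t (1 - u) u = 0]. *)
  pose J t := T t /\ exists wc, [/\ W wc.1, C wc.2 & t * s = wc.1 + wc.2].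
  have [||||u [Tu [[w c] /= [Ww Cc us]]] Ju] := Tss (J := J).
  - by move=> x [].
  - by split=> //; exists (0, 0); rewrite mul0r addr0.
  - move=> x y [Tx [[w c] /= [Ww Cc xs]]] [Ty [[w' c'] /= [Ww' Cc' ys]]].
    split; first exact: TD.
    exists (w + w', c + c'); split; [exact: WD|exact: CD|].
    by rewrite mulrDl xs ys addrACA.
  - move=> t x Tt [Tx [[w c] /= [Ww Cc xs]]]; split; first exact: TM.
    exists (t * w, t * c); split; [exact: WM|exact: CM|].
    by rewrite -mulrA xs mulrDr.
  have uu : u = u * u by apply: Ju; split=> //; exists (w, c).
  pose s' := (1 - u) * s.
  have TB : T (1 - u) by apply/TD/TN.
  have Cs' : C s'.
    apply: (maxC (fun z => exists t c, [/\ T t, C c & z = c + t * s'])).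
    - split=> [t _ _ Tt [a [d [Ta Cd ->]]] [b [e [Tb Ce ->]]]|_ [t [d [Tt Cd ->]]] Wz].
        exists (a + t * b), (d + t * e); split; [|exact: CDM|ring].
        by apply: TD => //; apply: TM.
      suff ts0 : t * (1 - u) = 0.
        by move: Wz; rewrite /s' mulrA ts0 mul0r addr0; apply: CW.
      have /Ju -> : J (t * (1 - u)).
        split; first exact: TM.
        exists (d + t * s', - d); split=> //; first exact: CN.
        by rewrite /= /s'; ring.
      by rewrite -mulrA mulrBl -uu mul1r subrr mulr0.
    - by move=> x Cx; exists 0, x; rewrite mul0r addr0.
    - by exists 1, 0; rewrite add0r mul1r.
  exists (w, c + s'); split=> //; first exact: CD.
  by rewrite /= addrA -us /s'; ring.
have [wc wcE] := boolp.choice dec.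
have uniq w c w' c' : W w -> C c -> W w' -> C c' -> w + c = w' + c' -> w = w'.
  move=> Ww Cc Ww' Cc' E; apply/eqP; rewrite -subr_eq0; apply/eqP; apply: CW.
    have -> : w - w' = c' - c by rewrite -(addrK c w) E; ring.
    by apply/CD/CN.
  by apply/WD/WN.
exists (fun s => (wc s).1); split.
- move=> x y; have [Wx Cx xE] := wcE x; have [Wy Cy yE] := wcE y.
  have [Wz Cz zE] := wcE (x + y).
  apply: (uniq _ _ _ ((wc x).2 + (wc y).2)) Wz Cz _ _ _; [exact: WD|exact: CD|].
  by rewrite -zE {1}xE {1}yE addrACA.
- move=> t x Tt; have [Wx Cx xE] := wcE x; have [Wz Cz zE] := wcE (t * x).
  apply: (uniq _ _ _ (t * (wc x).2)) Wz Cz _ _ _; [exact: WM|exact: CM|].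
  by rewrite -zE {1}xE mulrDr.
- by move=> x; case: (wcE x).
- move=> x Wx; have [Wz Cz zE] := wcE x.
  by apply: (uniq _ _ _ 0) Wz Cz Wx C0 _; rewrite -zE addr0.
Qed.

End Projection.

Section SeparableSemisimple.
Variables (R S : comNzRingType) (f : {rmorphism R -> S}).

Definition image_of : S -> Prop := fun s => exists r, s = f r.

Lemma semisimple_image : semisimple R -> semisimple_in image_of.
Proof.
move=> Rss J JT J0 JD JM; have [|u Ju uE] := Rss (fun r => J (f r)).
  split; first by rewrite rmorph0.
  by split=> [x y Jx Jy|a x Jx]; rewrite ?rmorphD ?rmorphM; [apply: JD|apply: JM => //; exists a].
exists (f u) => // x Jx; have [r xr] := JT x Jx.
by rewrite xr -rmorphM -uE // -xr.
Qed.

Lemma image_projection (W : S -> Prop) : semisimple R -> W 0 ->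
  (forall x y, W x -> W y -> W (x + y)) -> (forall r x, W x -> W (f r * x)) ->
  exists p : S -> S,
  [/\ forall x y, p (x + y) = p x + p y, forall r x, p (f r * x) = f r * p x,
      forall x, W (p x) & forall x, W x -> p x = x].
Proof.
move=> Rss W0 WD WM; have [||||||||p [pD pM pW pid]] := @linear_projection S image_of W.
- by exists 1; rewrite rmorph1.
- by move=> _ [r ->]; exists (- r); rewrite rmorphN.
- by move=> _ _ [r ->] [r' ->]; exists (r + r'); rewrite rmorphD.
- by move=> _ _ [r ->] [r' ->]; exists (r * r'); rewrite rmorphM.
- by [].
- by [].
- by move=> _ x [r ->]; apply: WM.
- exact: semisimple_image.
by exists p; split=> // r x; apply: pM; exists r.
Qed.

(* The [R]-linear projection onto [J], averaged over the separability element,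
   is [S]-linear. *)
Lemma separable_semisimple : semisimple R -> separable f -> semisimple S.
Proof.
move=> Rss [w [w1 wE]] J Ji; have [J0 [JD JM]] := Ji.
have [|p [pD pM pJ pid]] := image_projection Rss J0 JD; first by move=> r x; apply: JM.
exists (\sum_(z <- w) z.1 * p z.2); first by apply: ideal_sum => // z; apply: JM.
move=> x Jx; rewrite mulr_sumr.
have E := wE S (fun a b => a * p b).
transitivity (\sum_(z <- w) x * z.1 * p z.2); last by apply: eq_bigr => z _; rewrite mulrA.
rewrite E.
  rewrite -[LHS]mulr1 -w1 mulr_sumr; apply: eq_bigr => z _.
  by rewrite pid; [rewrite mulrCA|apply: is_idealMr].
by split=> *; rewrite ?pD ?pM; ring.
Qed.

Definition finite_module : Prop := exists (F : finType) (x : F -> S),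
  forall s, exists c : F -> R, s = \sum_i f (c i) * x i.

(** Let [p] project onto the span [W] of the first components [a i]. Moving [s] across the
    separability element gives [s = sum_i p(s a_i) b_i], so the products [a_j b_i] generate [S]. *)
Lemma separable_finite_module : semisimple R -> separable f -> finite_module.
Proof.
move=> Rss [w [w1 wE]]; pose n := size w; pose a (i : 'I_n) := (tnth (in_tuple w) i).1.
pose b (i : 'I_n) := (tnth (in_tuple w) i).2.
pose W s := exists c : 'I_n -> R, s = \sum_i f (c i) * a i.
have Wa i : W (a i).
  exists (fun j => (j == i)%:R); rewrite (bigD1 i) //= eqxx rmorph1 mul1r big1 ?addr0 //.
  by move=> j /negbTE ->; rewrite rmorph0 mul0r.
have [|||p [pD pM pW pid]] := @image_projection W Rss.
- by exists (fun=> 0); rewrite big1 // => i _; rewrite rmorph0 mul0r.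
- move=> _ _ [c ->] [d ->]; exists (fun i => c i + d i).
  by rewrite -big_split; apply: eq_bigr => i _; rewrite rmorphD mulrDl.
- move=> r _ [c ->]; exists (fun i => r * c i).
  by rewrite mulr_sumr; apply: eq_bigr => i _; rewrite rmorphM mulrA.
exists ('I_n * 'I_n)%type, (fun ij => a ij.2 * b ij.1) => s.
have [c cE] := fin_all_exists (fun i => pW (s * a i)).
exists (fun ij => c ij.1 ij.2).
have E := wE S (fun x y => p x * y).
transitivity (\sum_(z <- w) p z.1 * (s * z.2)).
  rewrite -[LHS]mulr1 -w1 mulr_sumr [LHS]big_tnth [RHS]big_tnth; apply: eq_bigr => i _.
  by rewrite pid; [rewrite mulrCA|apply: Wa].
rewrite -E; last by split=> *; rewrite ?pD ?pM; ring.
rewrite big_tnth -(pair_bigA _ (fun i j => f (c i j) * (a j * b i))) /=.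
apply: eq_bigr => i _; have := cE i; rewrite /a => ->.
by rewrite mulr_suml; apply: eq_bigr => j _; rewrite mulrA.
Qed.

End SeparableSemisimple.

Lemma field_semisimple (K : comNzRingType) :
  (forall x : K, x = 0 \/ exists y, x * y = 1) -> semisimple K.
Proof.
move=> Kf J Ji; have [J0 _] := Ji.
have [[x [Jx nx]]|nJ] := boolp.EM (exists x, J x /\ x <> 0).
  have [//|[y xy]] := Kf x; exists 1; last by move=> z; rewrite mulr1.
  by rewrite -xy; apply: is_idealMr.
exists 0 => // x Jx; rewrite mulr0; apply: boolp.contrapT => nx.
by apply: nJ; exists x.
Qed.

(** * Finitely many ideals *)

(** [FMIR] and [FIP] are both of this form, so the transfer lemmas serve ideals and subalgebras
    alike. *)
Definition finitely_many (X : Type) (E : (X -> Prop) -> Prop) : Prop :=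
  exists l : seq (X -> Prop), forall I, E I ->
    exists2 J, List.In J l & forall x, I x <-> J x.

Lemma finitely_many_sub (X : Type) (E E' : (X -> Prop) -> Prop) :
  (forall I, E I -> E' I) -> finitely_many E' -> finitely_many E.
Proof. by move=> EE' [l lE]; exists l => I /EE' /lE. Qed.

Lemma finitely_many_glue (X : Type) (E E1 E2 : (X -> Prop) -> Prop) (u1 u2 : X -> X) :
  (forall I, E I -> E1 (fun x => I (u1 x)) /\ E2 (fun x => I (u2 x))) ->
  (forall I, E I -> forall x, I x <-> I (u1 x) /\ I (u2 x)) ->
  finitely_many E1 -> finitely_many E2 -> finitely_many E.
Proof.
move=> EE Eu [l1 l1E] [l2 l2E].
exists (List.map (fun JJ : (X -> Prop) * (X -> Prop) => fun x => JJ.1 x /\ JJ.2 x)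
          (List.list_prod l1 l2)) => I EI.
have [/l1E [J1 J1l J1E] /l2E [J2 J2l J2E]] := EE I EI.
exists (fun x => J1 x /\ J2 x).
  by apply/List.in_map_iff; exists (J1, J2); split=> //; apply: List.in_prod.
by move=> x; rewrite (Eu I EI) J1E J2E.
Qed.

Lemma finitely_many_image (X Y : Type) (pi : X -> Y) (E : (X -> Prop) -> Prop)
    (E' : (Y -> Prop) -> Prop) :
  (forall I, E I -> E' (fun y => exists2 x, I x & pi x = y)) ->
  (forall I, E I -> forall x y, I x -> pi x = pi y -> I y) ->
  finitely_many E' -> finitely_many E.
Proof.
move=> EE sat [l lE]; exists (List.map (fun J x => J (pi x)) l) => I EI.
have [J Jl JE] := lE _ (EE I EI); exists (fun x => J (pi x)); first exact: List.in_map.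
move=> x; rewrite -JE; split=> [Ix|[y Iy yx]]; first by exists x.
exact: sat EI y x Iy yx.
Qed.

Lemma finitely_many_finite (X : eqType) (l : seq X) (E : (X -> Prop) -> Prop) :
  (forall x, x \in l) -> finitely_many E.
Proof.
move=> lX; suff [L LE] : exists L : seq (X -> Prop), forall I, exists2 J, List.In J L &
    forall x, x \in l -> (I x <-> J x).
  by exists L => I _; have [J JL JE] := LE I; exists J => // x; apply: JE.
elim: l {lX} => [|a l [L LE]]; first by exists [:: fun=> True] => I; exists (fun=> True); [left|].
exists (List.map (fun J x => x = a \/ J x) L ++ List.map (fun J x => x <> a /\ J x) L) => I.
have [J JL JE] := LE I; have [Ia|nIa] := boolp.EM (I a).
  exists (fun x => x = a \/ J x); first by apply/List.in_or_app; left; apply: List.in_map (JL).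
  move=> x; rewrite in_cons; case: eqP => [-> _|nxa /= /JE ->].
    by split=> // _; left.
  by split=> [|[]//]; right.
exists (fun x => x <> a /\ J x).
  by apply/List.in_or_app; right; apply: List.in_map (JL).
move=> x; rewrite in_cons; case: eqP => [-> _|nxa /= /JE ->]; last by split=> // [[]].
by split=> // [[]].
Qed.

Lemma finitely_many_nat (X : Type) (E : (X -> Prop) -> Prop) (J : nat -> X -> Prop) n :
  (forall I, E I -> exists2 i, (i < n)%N & forall x, I x <-> J i x) -> finitely_many E.
Proof.
move=> EJ; exists (List.map J (List.seq 0 n)) => I /EJ [i lin iE]; exists (J i) => //.
by apply/List.in_map/List.in_seq; split; [apply/leP|apply/ltP].
Qed.

Lemma count_ltn (T : Type) (a b : pred T) (l : seq T) (x : T) :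
  (forall y, a y -> b y) -> List.In x l -> b x -> ~~ a x -> (count a l < count b l)%N.
Proof.
move=> ab + bx nax; elim: l => [//|y l IH] /= [->|/IH lt].
  by rewrite bx (negbTE nax) add0n add1n ltnS; apply: sub_count.
by rewrite -addnS leq_add //; case: (boolP (a y)) => // /ab ->.
Qed.

Lemma min_measure (X : Type) (E : X -> Prop) (m : X -> nat) :
  (exists x, E x) -> exists2 x, E x & forall y, E y -> (m x <= m y)%N.
Proof.
case=> x; have [n] := ubnP (m x); elim: n x => [//|n IH] x /ltnSE le_xn Ex.
have [[y [Ey lt_yx]]|nE] := boolp.EM (exists y, E y /\ (m y < m x)%N).
  by apply: (IH y) => //; apply: leq_trans le_xn.
by exists x => // y Ey; rewrite leqNgt; apply/negP => lt; apply: nE; exists y.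
Qed.

Section FMIRTheory.
Variable A : comNzRingType.
Hypothesis Afm : FMIR A.

(** Count the listed sets contained in [I]: an inclusion of ideals with equal counts is an equality.
    Being bounded, the count yields both the minimum and the maximum condition. *)
Lemma FMIR_measure : exists2 m : (A -> Prop) -> nat,
  (exists b, forall I, (m I <= b)%N) &
  forall I J, is_ideal J -> (forall x, I x -> J x) -> (m J <= m I)%N -> forall x, J x -> I x.
Proof.
case: Afm => l lE;
exists (fun I => count (fun J : A -> Prop => boolp.asbool (forall x, J x -> I x)) l).
  by exists (size l) => I; apply: count_size.
move=> I J Ji IJ le x Jx; have [L Ll LE] := lE J Ji.
apply: boolp.contrapT => nIx; move: le; rewrite leqNgt => /negP; apply.
apply: (count_ltn (x := L)) => //.
- by move=> K /asboolP KI; apply/asboolP => y /KI /IJ.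
- by apply/asboolP => y /LE.
- by apply/negP => /asboolP LI; apply/nIx/LI/LE.
Qed.

Lemma FMIR_min (E : (A -> Prop) -> Prop) : (exists I, E I) -> (forall I, E I -> is_ideal I) ->
  exists2 I, E I & forall J, E J -> (forall x, J x -> I x) -> forall x, I x -> J x.
Proof.
move=> nE Ei; have [m _ mE] := FMIR_measure; have [I EI minI] := min_measure m nE.
by exists I => // J EJ JI; apply: mE => //; [apply: Ei|apply: minI].
Qed.

Lemma FMIR_max (E : (A -> Prop) -> Prop) : (exists I, E I) -> (forall I, E I -> is_ideal I) ->
  exists2 I, E I & forall J, E J -> (forall x, I x -> J x) -> forall x, J x -> I x.
Proof.
move=> nE Ei; have [m [b mb] mE] := FMIR_measure.
have [I EI maxI] := min_measure (fun I => b - m I)%N nE.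
exists I => // J EJ IJ; apply: mE => //; first exact: Ei.
by have := maxI J EJ; rewrite leq_sub2lE.
Qed.

End FMIRTheory.

(** * Primitive idempotents, and rings that are regular modulo a nilpotent element *)

Section Idempotents.
Variable A : comNzRingType.

(** Each chain of ideals [(x^n)] stabilizes; for commutative rings this means that every prime is
    maximal. *)
Definition pi_regular : Prop := forall x : A, exists n y, x ^+ n = x ^+ n.+1 * y.

Definition idem_noetherian : Prop := forall E : A -> Prop,
  (exists e, E e) -> (forall e, E e -> e * e = e) ->
  exists2 e, E e & forall e', E e' -> e' * e = e' -> e' = e.

(** Stronger than indecomposability: the factor [eA] is local with nil maximal ideal. *)
Definition primitive (e : A) : Prop :=
  [/\ e * e = e, e <> 0 &
      forall x, (exists y, e * x * y = e) \/ (exists n, e * x ^+ n = 0)].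

(** The idempotent [g] generates [(x^n.+1)]; the exponent [n.+1] makes [g] a multiple of [x] even
    when [n = 0], which [idem_split] uses. *)
Lemma pi_regular_idem (x : A) : pi_regular ->
  exists n y, let g := x ^+ n.+1 * y in g * g = g /\ x ^+ n.+1 * g = x ^+ n.+1.
Proof.
case/(_ x) => n [y xE]; have xE' : x ^+ n.+1 = x ^+ n.+1 * (x * y).
  by rewrite !exprS in xE *; rewrite [in LHS]xE; ring.
have xk k : x ^+ n.+1 = x ^+ n.+1 * (x * y) ^+ k.
  by elim: k => [|k IH]; rewrite ?expr0 ?mulr1 // [(x * y) ^+ _]exprS mulrA -xE'.
have xg : x ^+ n.+1 * (x ^+ n.+1 * y ^+ n.+1) = x ^+ n.+1.
  by rewrite -exprMn_comm; [rewrite -xk|apply: mulrC].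
exists n, (y ^+ n.+1); split=> //=.
by rewrite mulrAC xg.
Qed.

Lemma idem_split (e : A) : pi_regular -> e * e = e -> e <> 0 ->
  (forall g, g * g = g -> g * e = g -> g = e \/ e - g = e) -> primitive e.
Proof.
move=> preg ee ne He; split=> // x; have [n [y /= [gg xg]]] := pi_regular_idem x preg.
set g := _ * y in gg xg; have [||eg|eg] := He (e * g).
- by rewrite mulrACA ee gg.
- by rewrite mulrAC ee.
- by left; exists (x ^+ n * y); rewrite -[RHS]eg /g exprS; ring.
right; exists n.+1; rewrite -xg mulrCA.
suff -> : e * g = 0 by rewrite mulr0.
by apply: (addrI (e - e * g)); rewrite subrK eg addr0.
Qed.

(** A minimal idempotent [e] violating [Pr] does not split: for [0 < g < e], [Pr] would hold at [g]
    and [e - g], hence at their sum. So [e] is primitive. *)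
Lemma idem_ind (Pr : A -> Prop) : pi_regular -> idem_noetherian ->
  (forall e e', e * e = e -> e' * e' = e' -> e * e' = 0 -> Pr e -> Pr e' -> Pr (e + e')) ->
  Pr 0 -> (forall e, primitive e -> Pr e) -> forall e, e * e = e -> Pr e.
Proof.
move=> preg inoe PrD Pr0 Prp e0 e0e0; apply: boolp.contrapT => nPr.
have [||e [ee nPe] mine] := inoe (fun e => e * e = e /\ ~ Pr e).
- by exists e0.
- by move=> e [].
apply/nPe/Prp/idem_split => // [|g gg ge]; first by move=> e_0; apply: nPe; rewrite e_0.
have [Pg|nPg] := boolp.EM (Pr g); last by left; apply: mine.
have hh : (e - g) * (e - g) = e - g by rewrite mulrBl !mulrBr ee gg mulrC ge subrr subr0.
have [Ph|nPh] := boolp.EM (Pr (e - g)); last first.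
  by right; apply: mine => //; rewrite mulrBl ee ge.
by case: nPe; rewrite -(subrKC g e); apply: PrD => //; rewrite mulrBr ge gg subrr.
Qed.

Lemma FMIR_pi_regular : FMIR A -> pi_regular.
Proof.
move=> Afm x; pose I n := fun z : A => exists y, z = x ^+ n * y.
have [||_ [n ->] minI] := FMIR_min Afm (E := fun J => exists n, J = I n).
- by exists (I 0%N), 0%N.
- by move=> _ [n ->]; apply: principal_ideal.
have [|z [y yE]||y yE] := minI (I n.+1) _ _ (x ^+ n) _.
- by exists n.+1.
- by exists (x * y); rewrite yE exprS; ring.
- by exists 1; rewrite mulr1.
by exists n, y.
Qed.

Lemma FMIR_idem_noetherian : FMIR A -> idem_noetherian.
Proof.
move=> Afm E [e0 Ee0] Ei; pose I e := fun z : A => exists y, z = e * y.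
have [||_ [e Ee ->] minI] := FMIR_min Afm (E := fun J => exists2 e, E e & J = I e).
- by exists (I e0), e0.
- by move=> _ [e _ ->]; apply: principal_ideal.
exists e => // e' Ee' e'e.
have [|z [y ->]||y eE] := minI (I e') _ _ e _.
- by exists e'.
- by exists (e' * y); rewrite mulrA [e * _]mulrC e'e.
- by exists 1; rewrite mulr1.
by rewrite -e'e {1}eE mulrA Ei // -eE.
Qed.

(** Zorn is applied to annihilators of members of [E]: the union of a chain is an ideal whose
    generator already lies in one member, so it equals that member. A maximal annihilator belongs to
    a minimal idempotent. *)
Lemma semisimple_idem_noetherian : semisimple A -> idem_noetherian.
Proof.
move=> Ass E [e0 Ee0] Ei.
pose P (C : A -> Prop) := (forall x, ~ C x) \/ exists2 e, E e & forall x, C x <-> e * x = 0.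
have [|C [PC maxC]] := @zorn_union A P.
  move=> F FP tot;
  have [[X [FX [x Xx]]]|nF] := boolp.EM (exists X, F X /\ exists x, X x); last first.
    by left=> x [X FX Xx]; apply: nF; exists X; split=> //; exists x.
  right; pose U x := exists2 X, F X & X x.
  have FI Y y : F Y -> Y y -> is_ideal Y.
    move=> FY Yy; case: (FP Y FY) => [nY|[e _ YE]]; first by case: (nY y).
    have [I0 [ID IM]] := annihilator_ideal e; split; first exact/YE.
    by split=> [u v /YE Yu /YE Yv|a u /YE Yu]; apply/YE; [apply: ID|apply: IM].
  have Ui : is_ideal U.
    split; first by exists X => //; case: (FI X x FX Xx).
    split=> [u v [Y FY Yu] [Z FZ Zv]|a u [Y FY Yu]]; last first.
      by exists Y => //; case: (FI Y u FY Yu) => _ [_]; apply.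
    case: (tot Y Z FY FZ) => [YZ|ZY].
      by exists Z => //; case: (FI Z v FZ Zv) => _ [ZD _]; apply: ZD => //; apply: YZ.
    by exists Y => //; case: (FI Y u FY Yu) => _ [YD _]; apply: YD => //; apply: ZY.
  have [u [Y FY Yu] uE] := Ass U Ui; have Yi := FI Y u FY Yu.
  case: (FP Y FY) => [nY|[e Ee YE]]; first by case: (nY u).
  exists e => // z; split=> [/uE ->|ez]; last by exists Y => //; apply/YE.
  by apply/YE; case: Yi => _ [_]; apply.
case: PC => [nC|[e Ee CE]].
  case: (nC 0); apply: (maxC (fun x => e0 * x = 0)); last by rewrite mulr0.
    by right; exists e0.
  by move=> x /nC.
exists e => // e' Ee' e'e.
have : C (1 - e').
  apply: (maxC (fun x => e' * x = 0)).
  - by right; exists e'.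
  - by move=> x /CE ex; rewrite -e'e -mulrA ex mulr0.
  - by rewrite mulrBr mulr1 Ei // subrr.
by move/CE/eqP; rewrite mulrBr mulr1 subr_eq0 mulrC e'e => /eqP.
Qed.

Lemma onem_expr (a : A) n : exists w, (1 - a) ^+ n = 1 - a * w.
Proof.
elim: n => [|n [w IH]]; first by exists 0; rewrite expr0 mulr0 subr0.
by exists (w + 1 - a * w); rewrite exprS IH; ring.
Qed.

(** Ideals containing [1 - e] are the ideals of the factor [eA], and membership of [x] is decided by
    [e x] and [e' x]. *)
Lemma finitely_many_ideals_glue (e e' : A) : e * e = e -> e' * e' = e' ->
  finitely_many (fun L : A -> Prop => is_ideal L /\ L (1 - e)) ->
  finitely_many (fun L : A -> Prop => is_ideal L /\ L (1 - e')) ->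
  finitely_many (fun L : A -> Prop => is_ideal L /\ L (1 - (e + e'))).
Proof.
move=> ee e'e'; apply: (finitely_many_glue (u1 := fun x => e * x) (u2 := fun x => e' * x)).
  move=> L [Li L1]; have [L0 [LD LM]] := Li.
  have idl c : is_ideal (fun x => L (c * x)).
    split; first by rewrite mulr0.
    by split=> [x y Lx Ly|a x Lx]; rewrite ?mulrDr 1?mulrCA; [apply: LD|apply: LM].
  by split; split=> //; rewrite mulrBr mulr1 ?ee ?e'e' subrr.
move=> L [Li L1] x; have [L0 [LD LM]] := Li; split=> [Lx|[Lex Le'x]]; first by split; apply: LM.
have -> : x = x * (1 - (e + e')) + (e * x + e' * x) by ring.
by apply: (LD); [apply: LM|apply: LD].
Qed.

Section NilpotentGenerator.
Variables (p : A) (N : nat).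
Hypotheses (pN : p ^+ N = 0) (reg : forall x, exists y z, x = x * x * y + p * z).

(** [reg] says that [A / (p)] is von Neumann regular. So [x (1 - x y)] lies in [(p)], and expanding
    [x^N (1 - x y)^N = 0] solves for [x^N]. *)
Lemma regular_mod_nil_pi_regular : pi_regular.
Proof.
move=> x; have [y [z xE]] := reg x; have [w wE] := onem_expr (x * y) N.
exists N, (y * w); apply/eqP; rewrite -subr_eq0; apply/eqP.
have -> : x ^+ N - x ^+ N.+1 * (y * w) = x ^+ N * (1 - x * y) ^+ N by rewrite wE exprS; ring.
rewrite -exprMn_comm; last exact: mulrC.
have -> : x * (1 - x * y) = p * z by rewrite mulrBr mulr1 {1}xE; ring.
by rewrite exprMn_comm; [rewrite pN mul0r|apply: mulrC].
Qed.

(** Regular rings are reduced: modulo [p], each use of [x = x x y] turns [e x] into a multiple of a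
    higher power of [x]. *)
Lemma regular_mod_nil_nil (e x : A) n : e * x ^+ n = 0 -> exists z, e * x = p * z.
Proof.
move=> exn; have [y [z xE]] := reg x.
suff [v vE] : exists v, e * x = e * x ^+ n * (x * y ^+ n) + p * v.
  by exists v; rewrite vE exn mul0r add0r.
elim: n {exn} => [|n [v IH]]; first by exists 0; rewrite !expr0; ring.
exists (e * x ^+ n * y ^+ n * z + v); rewrite IH !exprS {2}xE; ring.
Qed.

(* In a local factor every ideal is generated by a power of [p]. *)
Lemma FMIR_regular_mod_nil : idem_noetherian -> FMIR A.
Proof.
move=> inoe; pose Pr (e : A) := finitely_many (fun L : A -> Prop => is_ideal L /\ L (1 - e)).
suff Pr1 : Pr 1.
  by apply: finitely_many_sub Pr1 => L Li; split=> //; rewrite subrr; case: Li.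
apply: idem_ind; rewrite ?mulr1 //.
- exact: regular_mod_nil_pi_regular.
- by move=> e e' ee e'e' _; apply: finitely_many_ideals_glue.
- exists [:: fun=> True] => L [Li L1]; exists (fun=> True); first by left.
  by move=> x; split=> // _; rewrite -[x]mulr1; case: Li => _ [_]; apply; rewrite subr0 in L1.
move=> e [ee ne eloc].
apply: (@finitely_many_nat _ _ (fun i x => exists y, e * x = e * p ^+ i * y) N.+1).
move=> L [Li L1]; have [L0 [LD LM]] := Li.
have Le x : L (e * x) -> L x.
  move=> Lx; have -> : x = e * x + x * (1 - e) by ring.
  by apply: LD => //; apply: LM.
have [i Lpi mini] : exists2 i, L (e * p ^+ i) & forall j, L (e * p ^+ j) -> (i <= j)%N.
  have [|i Li' mi] := @min_measure nat (fun i => L (e * p ^+ i)) id; last by exists i.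
  by exists N; rewrite pN mulr0.
exists i; first by rewrite ltnS; apply: mini; rewrite pN mulr0.
move=> x; split=> [Lx|[y xy]]; last by apply: Le; rewrite xy mulrC; apply: LM.
(* Write [e x = e p^j y] with [j < i]. A unit [y] would put [e p^j] in [L], against the minimality
   of [i]; so [y] is nilpotent in the factor, hence divisible by [p], and the exponent grows. *)
suff: forall j, (j <= i)%N -> exists y, e * x = e * p ^+ j * y by apply.
elim=> [|j IH] lej; first by exists x; rewrite expr0 mulr1.
have [y yE] := IH (ltnW lej); case: (eloc y) => [[z eyz]|[n eyn]].
  have /mini : L (e * p ^+ j); last by rewrite leqNgt lej.
  have -> : e * p ^+ j = z * e * x by rewrite -mulrA yE -{1}eyz; ring.
  exact: LM.
have [z zE] := regular_mod_nil_nil eyn; exists (e * z).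
rewrite yE exprS; transitivity (e * p ^+ j * (e * y)); last by rewrite zE -{1}ee; ring.
by rewrite -{1}ee; ring.
Qed.

End NilpotentGenerator.

Lemma semisimple_regular : semisimple A -> forall x : A, exists y, x = x * x * y.
Proof.
move=> Ass x; have [u [y ->] uE] := Ass _ (principal_ideal x).
by exists y; rewrite -mulrA; apply: uE; exists 1; rewrite mulr1.
Qed.

Lemma semisimple_FMIR : semisimple A -> FMIR A.
Proof.
move=> Ass; apply: (@FMIR_regular_mod_nil 0 1); first by rewrite expr1.
  by move=> x; have [y xE] := semisimple_regular Ass x; exists y, 0; rewrite mul0r addr0.
exact: semisimple_idem_noetherian.
Qed.

End Idempotents.

(** * Subalgebras over a field *)

Section FieldFIP.
Variables (K S : comNzRingType) (f : {rmorphism K -> S}).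

(** Cayley-Hamilton: if [C] describes multiplication by [t] on generators, [det (t - C)] kills all
    of them and hence [1]. *)
Lemma finite_module_integral (t : S) : finite_module f ->
  exists2 chi : {poly K}, chi \is monic & (map_poly f chi).[t] = 0.
Proof.
case=> F [x xS]; have [c cE] := fin_all_exists (fun i => xS (t * x i)).
pose n := #|F|; pose y (i : 'I_n) := x (enum_val i).
have sumF (g : F -> S) : \sum_i g i = \sum_(i < n) g (enum_val i).
  by rewrite (reindex _ (onW_bij _ (@enum_val_bij F))).
pose C : 'M[K]_n := \matrix_(i, j) c (enum_val i) (enum_val j).
pose M := t%:M - map_mx f C; exists (char_poly C); first exact: char_poly_monic.
have My : M *m \col_i y i = 0.
  apply/matrixP => i k; rewrite mulmxBl mul_scalar_mx !mxE /y cE sumF.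
  by apply/eqP; rewrite subr_eq0; apply/eqP/eq_bigr => j _; rewrite !mxE.
have dety i : \det M * y i = 0.
  have /matrixP/(_ i 0) : \adj M *m (M *m \col_i y i) = 0 by rewrite My mulmx0.
  by rewrite mulmxA mul_adj_mx mul_scalar_mx !mxE.
have -> : (map_poly f (char_poly C)).[t] = \det M.
  pose h : {rmorphism {poly K} -> S} := horner_eval t \o map_poly f.
  rewrite -[LHS]/(h (char_poly C)) -det_map_mx; congr (\det _).
  apply/matrixP => i j; rewrite !mxE [h _]/= /horner_eval rmorphB rmorphMn /=.
  by rewrite map_polyX map_polyC hornerD hornerN hornerC hornerMn hornerX.
have [d d1] := xS 1; rewrite -[LHS]mulr1 d1 sumF mulr_sumr big1 // => i _.
by rewrite mulrCA dety mulr0.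
Qed.

Hypothesis Kfield : forall x : K, x = 0 \/ exists y, x * y = 1.

(** Factors [X] of [chi] are moved into the power of [t] until the constant term is nonzero; it is
    then invertible and the equation is solved for [t^k]. *)
Lemma horner_pi_regular (chi : {poly K}) (t : S) k :
  chi != 0 -> t ^+ k * (map_poly f chi).[t] = 0 ->
  exists m (g : {poly K}), t ^+ m = t ^+ m.+1 * (map_poly f g).[t].
Proof.
elim/poly_ind: chi k => [|chi c IH] k; first by rewrite eqxx.
have [->|[c' cc']] := Kfield c.
  rewrite addr0 => nz; have {nz} nchi : chi != 0 by apply: contra_neq nz => ->; rewrite mul0r.
  rewrite rmorphM /= map_polyX hornerMX => E; apply: (IH k.+1) => //.
  by rewrite -[RHS]E exprS; ring.
move=> _; rewrite rmorphD rmorphM /= map_polyX map_polyC hornerMXaddC => E.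
exists k, (- c' *: chi); rewrite map_polyZ hornerZ rmorphN exprS.
have fcc : f c * f c' = 1 by rewrite -rmorphM cc' rmorph1.
apply/eqP; rewrite -subr_eq0; apply/eqP.
rewrite -[RHS](mul0r (f c')) -[X in X * f c']E -{1}[t ^+ k]mulr1 -fcc; ring.
Qed.

Lemma subalg_horner (T : S -> Prop) (t : S) (g : {poly K}) :
  is_subalg f T -> T t -> T (map_poly f g).[t].
Proof.
move=> [Tf [TD [TN TM]]] Tt; elim/poly_ind: g => [|g c IH].
  by rewrite rmorph0 horner0 -(rmorph0 f).
rewrite rmorphD rmorphM /= map_polyX map_polyC hornerMXaddC.
by apply: TD; [apply: TM|apply: Tf].
Qed.

Lemma regular_reduced : (forall x : S, exists y, x = x * x * y) ->
  forall (x : S) n, x ^+ n = 0 -> x = 0.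
Proof.
move=> reg x n xn; have [y xE] := reg x.
suff -> : x = x ^+ n * (x * y ^+ n) by rewrite xn mul0r.
elim: n {xn} => [|n IH]; first by rewrite !expr0; ring.
by rewrite {1}IH {2}xE !exprS; ring.
Qed.

(** Quasi-inverses are polynomials over [K] in the element, so [T] is von Neumann regular; an ideal
    [J] of [T] then gets its idempotent generator from the ideal [J S] of [S]. *)
Lemma subalg_semisimple (T : S -> Prop) : semisimple S -> finite_module f ->
  is_subalg f T -> semisimple_in T.
Proof.
move=> Sss Sfin Talg; have [Tf [TD [TN TM]]] := Talg.
have red := regular_reduced (semisimple_regular Sss).
have regT t : T t -> exists2 y, T y & t = t * t * y.
  move=> Tt; have [chi chi_mon chit] := finite_module_integral t Sfin.
  have [||m [g tE]] := @horner_pi_regular chi t 0; rewrite ?monic_neq0 ?expr0 ?mul1r //.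
  set y := (map_poly f g).[t] in tE; exists y; first exact: subalg_horner.
  apply/eqP; rewrite -subr_eq0; apply/eqP/(red _ m.+1).
  have -> : t - t * t * y = t * (1 - t * y) by ring.
  rewrite exprMn_comm; last exact: mulrC.
  have -> : t ^+ m.+1 * (1 - t * y) ^+ m.+1
      = (t ^+ m - t ^+ m.+1 * y) * (t * (1 - t * y) ^+ m) by rewrite !exprS; ring.
  by rewrite -tE subrr mul0r.
move=> J JT J0 JD JM.
have JN x : J x -> J (- x).
  by move=> Jx; rewrite -mulN1r; apply: JM => //; rewrite -(rmorph1 f); apply: TN.
(* This is [J S]: each [x] in [J] is fixed by an idempotent [x y] of [J], and [u + v - u v] absorbs
   both idempotents [u] and [v]. *)
pose N z := exists u, [/\ J u, u * u = u & z = z * u].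
have Ni : is_ideal N.
  split; first by exists 0; rewrite mulr0.
  split=> [x y [u [Ju uu xu]] [v [Jv vv yv]]|a x [u [Ju uu xu]]]; last first.
    by exists u; split=> //; rewrite -mulrA -xu.
  exists (u + v - u * v); split.
  - by apply: (JD); [apply: JD|apply: JN; apply: JM => //; apply: JT].
  - transitivity (u * u + v * v + u * v + u * v - (u * u) * v - (u * u) * v
      - (v * v) * u - (v * v) * u + (u * u) * (v * v)); first by ring.
    by rewrite uu vv; ring.
  - transitivity (x * u + y * v); first by rewrite -xu -yv.
    rewrite [in RHS](_ : (x + y) * (u + v - u * v) = x * u + y * v + (x - x * u) * v
      + (y - y * v) * u); last by ring.
    by rewrite -xu -yv !subrr !mul0r !addr0.
have [w [u [Ju uu wu]] wE] := Sss N Ni; exists u => // x Jx.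
have Nx : N x.
  have [y Ty xE] := regT x (JT x Jx); exists (x * y); split.
  - by rewrite mulrC; apply: JM.
  - by rewrite mulrACA mulrA -xE.
  - by rewrite mulrA.
by rewrite {1}(wE x Nx) {1}wu mulrA -(wE x Nx).
Qed.

(* A subalgebra [T] is recovered from the kernel of [S (x)_K S -> S (x)_T S] by means of
   a [T]-linear projection onto [T], and [S (x)_K S] has finitely many ideals. *)
Lemma separable_FIP : finite_type f -> separable f -> FIP f.
Proof.
move=> Sft Ssep; have Kss := field_semisimple Kfield.
have Sss := separable_semisimple Kss Ssep.
have Sfin := separable_finite_module Kss Ssep.
have [B [i1 [i2 [mu [i12 _ spanB phiB _]]]]] := tensor_square Sft.
have Bss := separable_semisimple Sss (separable_tensor i12 spanB Ssep).
have [l lE] := semisimple_FMIR Bss.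
exists (List.map (fun J s => J (i1 s - i2 s)) l) => T Talg.
have [Tf [TD [TN TM]]] := Talg; pose JT := ideal_gen (fun z => exists2 t, T t & z = i1 t - i2 t).
have [J Jl JE] := lE JT (ideal_gen_ideal _).
exists (fun s => J (i1 s - i2 s)); first exact: (List.in_map (fun J s => J (i1 s - i2 s))).
move=> s; rewrite -JE; split=> [Ts|JTs]; first by apply: mem_ideal_gen; exists s.
have T1 : T 1 by rewrite -(rmorph1 f).
have T0 : T 0 by rewrite -(rmorph0 f).
have [p [pD pM pT pid]] := linear_projection T1 TN TD TM T0 TD TM
  (subalg_semisimple Sss Sfin Talg).
(* By [T]-linearity the map [x (x) y |-> p x * y] kills [JT]; on [s (x) 1 - 1 (x) s] its value is
   [p s - s], so [s] lies in [T]. *)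
have bal : balanced f (fun x y => p x * y).
  by split=> [x x' y|x y y'|r x y]; rewrite ?pD ?pM //; ring.
have [phi phiE] := phiB S _ bal.
have phi0 : forall b, phi (b * (i1 s - i2 s)) = 0.
  apply: (JTs (fun z => forall b, phi (b * z) = 0)).
    split; first by move=> b; rewrite mulr0 raddf0.
    split=> [x y x0 y0 b|a x x0 b]; first by rewrite mulrDr raddfD x0 y0 addr0.
    by rewrite mulrA.
  move=> _ [t Tt ->] b; have [w ->] := spanB b.
  rewrite mulr_suml raddf_sum big1 // => z _.
  have -> : i1 z.1 * i2 z.2 * (i1 t - i2 t) = i1 (t * z.1) * i2 z.2 - i1 z.1 * i2 (t * z.2).
    by rewrite !rmorphM; ring.
  by rewrite raddfB /= !phiE pM //; ring.
have e1 : phi (i1 s) = p s by rewrite -[i1 s]mulr1 -(rmorph1 i2) phiE mulr1.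
have e2 : phi (i2 s) = s by rewrite -[i2 s]mul1r -(rmorph1 i1) phiE pid // mul1r.
have := phi0 1; rewrite mul1r raddfB /= e1 e2.
by move/eqP; rewrite subr_eq0 => /eqP <-.
Qed.

End FieldFIP.

(** * Local base rings *)

Lemma InP (T : eqType) (x : T) (l : seq T) : List.In x l <-> x \in l.
Proof.
elim: l => [|y l IH] //=; rewrite in_cons; split=> [[->|/IH ->]|/orP [/eqP ->|/IH]].
- by rewrite eqxx.
- by rewrite orbT.
- by left.
- by right.
Qed.

Section Nilpotents.
Variable A : comNzRingType.

Definition nilpotent (x : A) : Prop := exists n, x ^+ n = 0.

Definition local_ring : Prop := forall x : A, (exists y, x * y = 1) \/ nilpotent x.

Definition finite_mod (I : A -> Prop) : Prop :=
  exists l : seq A, forall x, exists2 z, z \in l & I (x - z).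

Lemma nilpotent_ideal : is_ideal nilpotent.
Proof.
split; first by exists 1%N; rewrite expr1.
split=> [x y [n xn] [m ym]|a x [n xn]]; last first.
  by exists n; rewrite exprMn_comm; [rewrite xn mulr0|apply: mulrC].
exists (n + m)%N; rewrite exprDn big1 // => i _.
have [le_mi|lt_im] := leqP m i.
  by rewrite -(subnKC le_mi) exprD ym mul0r mulr0 mul0rn.
have le : (n <= n + m - i)%N by rewrite -addnBA ?leq_addr // ltnW.
by rewrite -(subnKC le) exprD xn !mul0r mul0rn.
Qed.

Lemma not_nilpotent1 : ~ nilpotent 1.
Proof. by case=> n; rewrite expr1n => /eqP; rewrite oner_eq0. Qed.

Lemma idem_nilpotent (g : A) : g * g = g -> nilpotent g -> g = 0.
Proof.
move=> gg [n gn]; have gk k : g ^+ k.+1 = g by elim: k => [|k IH]; rewrite ?expr1 // exprS IH.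
by rewrite -(gk n) exprS gn mulr0.
Qed.

Definition adjoin (I : A -> Prop) (xs : seq A) : A -> Prop :=
  foldr (fun r J x => exists y z, J z /\ x = r * y + z) I xs.

Lemma adjoin_ideal I xs : is_ideal I -> is_ideal (adjoin I xs).
Proof.
move=> Ii; elim: xs => [//|r xs [J0 [JD JM]]] /=; split.
  by exists 0, 0; rewrite mulr0 addr0.
split=> [_ _ [y [z [Jz ->]]] [y' [z' [Jz' ->]]]|a _ [y [z [Jz ->]]]].
  by exists (y + y'), (z + z'); split; [apply: JD|ring].
by exists (a * y), (a * z); split; [apply: JM|ring].
Qed.

Lemma mem_adjoin I xs x : is_ideal I -> x \in xs -> adjoin I xs x.
Proof.
move=> Ii; elim: xs => [//|r xs IH] /=; rewrite in_cons => /orP [/eqP ->|/IH xx].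
  by exists 1, 0; rewrite mulr1 addr0; split=> //; case: (adjoin_ideal xs Ii).
by exists 0, x; rewrite mulr0 add0r.
Qed.

Lemma finite_mod_sub (I J : A -> Prop) : (forall x, I x -> J x) -> finite_mod I -> finite_mod J.
Proof.
by move=> IJ [l lE]; exists l => x; have [z zl Iz] := lE x; exists z; [|apply: IJ].
Qed.

(* Each quotient [(r^k) / (r^(k+1))] is a quotient of [A / (r)]. *)
Lemma finite_mod_nilpotent (I : A -> Prop) xs : is_ideal I ->
  (forall x, x \in xs -> nilpotent x) -> finite_mod (adjoin I xs) -> finite_mod I.
Proof.
move=> Ii; elim: xs => [//|r xs IH] /= nilx [l lE].
apply: IH => [x xx|]; first by apply: nilx; rewrite in_cons xx orbT.
set J := adjoin I xs in lE *; have Ji : is_ideal J by apply: adjoin_ideal.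
have [J0 [JD JM]] := Ji; have [|n rn] := nilx r; first by rewrite mem_head.
have [l' l'E] : exists l' : seq A, forall x, exists2 z, z \in l' &
    exists y, J (x - z - r ^+ n * y).
  elim: n {rn} => [|n [l1 l1E]].
    by exists [:: 0] => x; exists 0; rewrite ?mem_head //; exists x;
      rewrite expr0 mul1r subr0 subrr.
  exists [seq z + r ^+ n * c | z <- l1, c <- l] => x.
  have [z zl [y Jy]] := l1E x; have [c cl [y' [i [Ji' yE]]]] := lE y.
  exists (z + r ^+ n * c); first by apply: allpairs_f.
  exists y'; have -> : x - (z + r ^+ n * c) - r ^+ n.+1 * y' =
      (x - z - r ^+ n * y) + r ^+ n * (y - c - r * y') by rewrite exprS; ring.
  by apply: (JD) => //; apply: JM; rewrite yE addrC addKr.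
exists l' => x; have [z zl [y Jy]] := l'E x; exists z => //.
by rewrite rn mul0r subr0 in Jy.
Qed.

(** An ideal maximal among those generated by finitely many nilpotents absorbs every further
    nilpotent. *)
Lemma FMIR_nilpotent_fg : FMIR A -> exists2 xs : seq A,
  (forall x, x \in xs -> nilpotent x) &
  forall x, nilpotent x -> adjoin (fun x => x = 0) xs x.
Proof.
move=> Afm; have zi := zero_ideal A.
pose E I := exists2 xs : seq A, (forall x, x \in xs -> nilpotent x) &
  I = adjoin (fun x => x = 0) xs.
have [||_ [xs nilx ->] maxI] := FMIR_max Afm (E := E).
- by exists (adjoin (fun x => x = 0) [::]), [::].
- by move=> _ [xs _ ->]; apply: adjoin_ideal.
exists xs => // x nx; apply: (maxI (adjoin (fun x => x = 0) (x :: xs))).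
- by exists (x :: xs) => // y; rewrite in_cons => /orP [/eqP ->|/nilx].
- by move=> y xy; exists 0, y; rewrite mulr0 add0r.
- by apply: mem_adjoin => //; rewrite mem_head.
Qed.

(* If the residue field is infinite, a principal ideal [(p)] maximal among those
   generated by a nilpotent absorbs each nilpotent [y]: two of the ideals [(p + u y)]
   with [u] varying modulo nilpotents coincide. *)
Lemma local_dichotomy : FMIR A -> local_ring ->
  (exists l : seq A, forall x, x \in l) \/
  exists2 p, nilpotent p & forall x, nilpotent x -> exists y, x = p * y.
Proof.
move=> Afm Aloc; have nili := nilpotent_ideal; have [_ [nilD nilM]] := nili.
have [fin|nfin] := boolp.EM (finite_mod nilpotent); [left|right].
  have [xs nilx xsE] := FMIR_nilpotent_fg Afm.
  have [|l lE] := finite_mod_nilpotent (zero_ideal A) nilx; first exact: finite_mod_sub fin.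
  by exists l => x; have [z zl /eqP] := lE x; rewrite subr_eq0 => /eqP ->.
pose I p := fun x : A => exists y, x = p * y.
have [||_ [p np ->] maxI] := FMIR_max Afm (E := fun J => exists2 p, nilpotent p & J = I p).
- by exists (I 0), 0 => //; case: nili.
- by move=> _ [p _ ->]; apply: principal_ideal.
exists p => // y ny.
have [u [u' [uu IE]]] : exists u u', ~ nilpotent (u - u') /\
    forall x, I (p + u * y) x <-> I (p + u' * y) x.
  (* Otherwise one [u] chosen for each listed ideal of the form [(p + u y)] would give finitely many
     representatives modulo nilpotents. *)
  apply: boolp.contrapT => H; apply: nfin; have [l lE] := Afm.
  have /boolp.choice [c cE] : forall J : A -> Prop, exists u,
      (exists u', forall x, I (p + u' * y) x <-> J x) -> forall x, I (p + u * y) x <-> J x.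
    move=> J; have [[u uE]|nu] := boolp.EM (exists u', forall x, I (p + u' * y) x <-> J x).
      by exists u.
    by exists 0.
  exists (List.map c l) => x; have [J Jl JE] := lE _ (principal_ideal (p + x * y)).
  exists (c J); first exact: (proj1 (InP _ _) (List.in_map c _ _ Jl)).
  apply: boolp.contrapT => nn; apply: H; exists x, (c J); split=> // z.
  exact: iff_trans (JE z) (iff_sym (cE J (ex_intro _ x JE) z)).
set q := p + u * y; have Iq : is_ideal (I q) by apply: principal_ideal.
(* As [u - u'] is a unit, [(q)] contains [y] and then [p]; since [q] is nilpotent, maximality gives
   [(q) = (p)]. *)
have [[v uv]|//] := Aloc (u - u').
have q1 : I q q by exists 1; rewrite mulr1.
have q2 : I q (p + u' * y) by apply/IE; exists 1; rewrite mulr1.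
have [_ [ID IM]] := Iq.
have Iy : I q y.
  have -> : y = v * (q - (p + u' * y)) by rewrite -[LHS]mul1r -uv /q; ring.
  by apply: (IM); apply: is_idealB.
have Ip : I q p.
  have -> : p = q - u * y by rewrite /q; ring.
  by apply: is_idealB => //; apply: IM.
apply: (maxI (I q)) => //.
  by exists q => //; apply: nilD => //; apply: nilM.
by move=> _ [z ->]; apply: is_idealMr.
Qed.

End Nilpotents.

Section ResidueAlgebra.
Variables (R S : comNzRingType) (f : {rmorphism R -> S}).
Hypothesis Ssep : separable f.

Definition extended (P : R -> Prop) : S -> Prop :=
  ideal_gen (fun z => exists2 r, P r & z = f r).

Lemma residue_algebra (P : R -> Prop) : is_ideal P ->
  (forall x, P x \/ exists y, P (x * y - 1)) -> ~ extended P 1 ->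
  exists (B : comNzRingType) (pi : {rmorphism S -> B}),
  [/\ forall b, exists s, pi s = b, forall s, pi s = 0 <-> extended P s, semisimple B &
      exists (F : finType) (x : F -> B), forall b, exists c : F -> R,
        b = \sum_i pi (f (c i)) * x i].
Proof.
move=> Pi Pmax nPS1.
have [|K [p [p_surj pE]]] := quotient_ring Pi.
  by move=> P1; apply: nPS1; apply: mem_ideal_gen; exists 1; rewrite ?rmorph1.
have [B [pi [pi_surj piE]]] := quotient_ring (ideal_gen_ideal _ : is_ideal (extended P)) nPS1.
have [|f' f'E] := @quotient_map R S K B f p pi p_surj.
  by move=> x /pE Px; apply/piE; apply: mem_ideal_gen; exists x.
have f'sep := separable_quotient pi_surj f'E Ssep.
have Kss : semisimple K.
  apply: field_semisimple => x; have [r <-] := p_surj x; case: (Pmax r) => [Pr|[y Py]].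
    by left; apply/pE.
  right; exists (p y); apply/eqP; rewrite -subr_eq0 -rmorphM -(rmorph1 p) -rmorphB.
  exact/eqP/pE.
exists B, pi; split=> //; first exact: separable_semisimple Kss f'sep.
have [F [x xE]] := separable_finite_module Kss f'sep; exists F, x => b.
have [c ->] := xE b; have [d dE] := fin_all_exists (fun i => p_surj (c i)).
by exists d; apply: eq_bigr => i _; rewrite -f'E dE.
Qed.

Hypotheses (Rfm : FMIR R) (Rloc : local_ring R).

Lemma extended_nilpotent s : extended (@nilpotent R) s -> nilpotent s.
Proof.
apply; first exact: nilpotent_ideal.
by move=> _ [r [n rn] ->]; exists n; rewrite -rmorphXn rn rmorph0.
Qed.

Let residue : exists (B : comNzRingType) (pi : {rmorphism S -> B}),
  [/\ forall b, exists s, pi s = b, forall s, pi s = 0 <-> extended (@nilpotent R) s,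
      semisimple B &
      exists (F : finType) (x : F -> B), forall b, exists c : F -> R,
        b = \sum_i pi (f (c i)) * x i].
Proof.
apply: residue_algebra; first exact: nilpotent_ideal.
  move=> x; case: (Rloc x) => [[y xy]|]; [right|by left].
  by exists y; rewrite xy subrr; case: (nilpotent_ideal R).
by move/extended_nilpotent/not_nilpotent1.
Qed.

(** The residue algebra is finite, being a finitely generated module over a finite ring; this lifts
    to [S] since the nilradical of [R] is generated by finitely many elements, whose images are
    nilpotent. *)
Lemma local_finite : (exists l : seq R, forall x, x \in l) -> exists l : seq S, forall x, x \in l.
Proof.
case=> lR lRE; have [B [pi [pi_surj piE _ [F [x xE]]]]] := residue.
have [xs nilx xsE] := FMIR_nilpotent_fg Rfm.
have [s sK] := boolp.choice pi_surj.
pose lB := [seq \sum_i pi (f (nth 0 lR (g i))) * x i | g : {ffun F -> 'I_(size lR)}].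
have lBE b : b \in lB.
  have [c ->] := xE b; apply/mapP.
  have ltc i : (index (c i) lR < size lR)%N by rewrite index_mem.
  exists [ffun i => Ordinal (ltc i)]; first by rewrite mem_enum.
  by apply: eq_bigr => i _; rewrite ffunE /= nth_index.
have [|||l lE] := @finite_mod_nilpotent S (fun x => x = 0) (map f xs).
- exact: zero_ideal.
- by move=> _ /mapP [r /nilx [n rn] ->]; exists n; rewrite -rmorphXn rn rmorph0.
- exists (map s lB) => z; exists (s (pi z)); first exact: map_f.
  have : extended (@nilpotent R) (z - s (pi z)) by apply/piE; rewrite rmorphB sK subrr.
  have zi := adjoin_ideal (map f xs) (zero_ideal S); apply=> // _ [r /xsE rxs ->].
  elim: (xs) r rxs => [|r' xs' IH] r /=; first by move=> ->; rewrite rmorph0.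
  by case=> y [z' [/IH z'E ->]]; exists (f y), (f z'); rewrite rmorphD rmorphM.
by exists l => z; have [z' z'l /eqP] := lE z; rewrite subr_eq0 => /eqP ->.
Qed.

Lemma local_FMIR : FMIR S.
Proof.
case: (local_dichotomy Rfm Rloc) => [/local_finite [l lE]|[p [N pN] pE]].
  exact: finitely_many_finite lE.
have [B [pi [pi_surj piE Bss _]]] := residue.
apply: (@FMIR_regular_mod_nil _ (f p) N); first by rewrite -rmorphXn pN rmorph0.
- move=> x; have [b bE] := semisimple_regular Bss (pi x); have [y yb] := pi_surj b.
  have xy : extended (@nilpotent R) (x - x * x * y).
    by apply/piE; rewrite rmorphB !rmorphM yb -bE subrr.
  have [_ [r /pE [z ->] ->]|z zE] := xy _ (principal_ideal (f p)) _.
  - by exists (f z); rewrite rmorphM.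
  by exists y, z; rewrite -zE addrC subrK.
(* A minimal idempotent is found in the semisimple quotient. If [e' <= e] have the same image there,
   [e - e'] is idempotent and nilpotent, so zero. *)
move=> E [e0 Ee0] Ei.
have [||_ [e Ee <-] mine] :=
  semisimple_idem_noetherian Bss (E := fun b => exists2 e, E e & pi e = b).
- by exists (pi e0), e0.
- by move=> _ [e Ee <-]; rewrite -rmorphM Ei.
exists e => // e' Ee' e'e; apply/eqP; rewrite eq_sym -subr_eq0; apply/eqP.
apply: idem_nilpotent; first by rewrite mulrBl !mulrBr !Ei // e'e mulrC e'e subrr subr0.
apply: extended_nilpotent; apply/piE; rewrite rmorphB; apply/eqP; rewrite subr_eq0 eq_sym.
by apply/eqP/mine; [exists e'|rewrite -rmorphM e'e].
Qed.

End ResidueAlgebra.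

(** * Localization at a prime *)

Section LocalIdempotent.
Variables (A : comNzRingType) (P : A -> Prop).

(* The localization at [P] is then the factor [eA] of [A]. *)
Definition splits_at (e : A) : Prop :=
  [/\ e * e = e, ~ P e, forall x, P x -> exists n, e * x ^+ n = 0 &
      forall x, ~ P x -> exists y, e * x * y = e].

Lemma prime_exp x n : is_prime P -> P (x ^+ n) -> P x.
Proof.
case=> _ [P1 PM]; elim: n => [|n IH]; first by rewrite expr0.
by rewrite exprS => /PM [].
Qed.

Lemma splits_at_nil e x n : is_prime P -> splits_at e -> e * x ^+ n = 0 -> P x.
Proof.
move=> Pp [_ nPe _ _] E; apply: (@prime_exp x n) => //.
by have [[P0 _] [_ PM]] := Pp; case: (PM e (x ^+ n)); rewrite ?E.
Qed.

(** Take a minimal idempotent outside [P]. The minimality is kept in the conclusion because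
    [fibre_types] uses it to compare the idempotents of [S] and [R]. *)
Lemma prime_splits_at : FMIR A -> is_prime P ->
  exists2 e, splits_at e &
    forall g, g * g = g -> ~ P g -> g * e = g -> g = e.
Proof.
move=> Afm Pp; have [Pi [P1 PM]] := Pp; have [P0 [PD _]] := Pi.
have [||e [ee nPe] mine] := FMIR_idem_noetherian Afm (E := fun e => e * e = e /\ ~ P e).
- by exists 1; rewrite mulr1.
- by move=> e [].
have mine' g : g * g = g -> ~ P g -> g * e = g -> g = e by move=> *; apply: mine.
exists e => //; have [|g gg ge|_ _ eloc] := @idem_split _ e (FMIR_pi_regular Afm) ee.
- by move=> e0; apply: nPe; rewrite e0.
- have [Pg|nPg] := boolp.EM (P g); last by left; apply: mine'.
  right; apply: mine'.
  + by rewrite mulrBl !mulrBr ee gg mulrC ge subrr subr0.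
  + by move=> Peg; apply: nPe; rewrite -(subrK g e); apply: PD.
  + by rewrite mulrBl ee ge.
split=> // x Px; case: (eloc x) => //.
- by case=> y exy; case: nPe; rewrite -exy; apply: is_idealMr => //; case: Pi => _ [_]; apply.
- by case=> n exn; case: Px; apply: (@prime_exp x n) => //; case: (PM e (x ^+ n)); rewrite ?exn.
Qed.

End LocalIdempotent.

Section PrimitiveIdempotent.
Variables (A : comNzRingType) (e : A).
Hypothesis eprim : primitive e.

(** The preimage in [A] of the maximal ideal of the local factor [eA]. *)
Definition primitive_prime : A -> Prop := fun x => nilpotent (e * x).

Lemma primitive_prime_prime : is_prime primitive_prime.
Proof.
have [ee ne eloc] := eprim; have [n0 [nD nM]] := nilpotent_ideal A.
rewrite /primitive_prime; split; last split.
- split; first by rewrite mulr0.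
  by split=> [x y nx ny|a x nx]; rewrite ?mulrDr 1?mulrCA; [apply: nD|apply: nM].
- by rewrite mulr1 => /(idem_nilpotent ee).
- move=> x y nxy; case: (eloc x) => [[z exz]|[n exn]].
    right; have -> : e * y = z * (e * (x * y)) by rewrite -{1}exz; ring.
    exact: nM.
  left; exists n.+1; rewrite exprMn_comm; last exact: mulrC.
  have -> : e ^+ n.+1 * x ^+ n.+1 = (e * x ^+ n) * (e ^+ n * x) by rewrite !exprS; ring.
  by rewrite exn mul0r.
Qed.

Lemma primitive_splits_at : splits_at primitive_prime e.
Proof.
have [ee ne eloc] := eprim; have [_ [P1 _]] := primitive_prime_prime.
have ek k : e ^+ k.+1 = e by elim: k => [|k IH]; rewrite ?expr1 // exprS IH.
split=> //.
- by rewrite /primitive_prime ee => /(idem_nilpotent ee).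
- move=> x [n exn]; exists n; rewrite -(ek n) exprS -mulrA.
  by rewrite -exprMn_comm; [rewrite exn mulr0|apply: mulrC].
- move=> x Px; case: (eloc x) => // [[n exn]]; case: Px; exists n.+1.
  rewrite exprMn_comm; last exact: mulrC.
  have -> : e ^+ n.+1 * x ^+ n.+1 = (e * x ^+ n) * (e ^+ n * x) by rewrite !exprS; ring.
  by rewrite exn mul0r.
Qed.

End PrimitiveIdempotent.

Section LocalizationAtIdempotent.
Variables (A : comNzRingType) (P : A -> Prop) (e : A).
Hypotheses (Pp : is_prime P) (eP : splits_at P e).

Let ee : e * e = e. Proof. by case: eP. Qed.
Let nPe : ~ P e. Proof. by case: eP. Qed.
Let eU x : ~ P x -> exists y, e * x * y = e. Proof. by case: eP => _ _ _; apply. Qed.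
Let P0 : P 0. Proof. by case: Pp => [[]]. Qed.
Let nP1 : ~ P 1. Proof. by case: Pp => [_ []]. Qed.
Let PM x y : P (x * y) -> P x \/ P y. Proof. by case: Pp => [_ [_]]; apply. Qed.
Let Pi : is_ideal P. Proof. by case: Pp. Qed.

(** Elements outside [P] are units in the factor [eA], so the witness [u] of [loc_eq] can be taken
    to be [e]. *)
Lemma loc_eqE (x y : A * A) :
  loc_eq (compl P) x y <-> e * (x.1 * y.2 - y.1 * x.2) = 0.
Proof.
split=> [[u nPu E]|E]; last by exists e.
have [z euz] := eU nPu.
by rewrite -euz -!mulrA [z * _]mulrC mulrA -mulrA [X in _ * X]mulrA E mul0r mulr0.
Qed.

Lemma loc_fieldE : loc_field (compl P) <-> forall x, P x -> e * x = 0.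
Proof.
split=> [[_ H] x Px|H].
  apply: boolp.contrapT => nex.
  have [||[a b] /= nPb /loc_eqE /= E] := H (x, 1) => //.
    by move=> /loc_eqE /=; rewrite mul0r subr0 mulr1.
  have : P (e * b).
    have -> : e * b = e * a * x - e * (x * a * 1 - 1 * (1 * b)) by ring.
    by rewrite E subr0; case: Pi => _ [_]; apply.
  by case/PM.
split.
  by move/loc_eqE => /=; rewrite mul0r subr0 !mulr1 => e0; apply: nPe; rewrite e0.
move=> [a s] /= nPs nz; have nPa : ~ P a.
  by move=> Pa; apply: nz; apply/loc_eqE; rewrite /= mul0r subr0 mulr1 H.
have [y eay] := eU nPa; exists (s * y, 1) => //; apply/loc_eqE => /=.
have -> : e * (a * (s * y) * 1 - 1 * (s * 1)) = s * (e * a * y) - s * e by ring.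
by rewrite eay subrr.
Qed.

Lemma loc_finiteE : loc_finite (compl P) <-> finite_mod (fun x => e * x = 0).
Proof.
have /boolp.choice [v vE] : forall x, exists y, ~ P x -> e * x * y = e.
  move=> x; have [Px|nPx] := boolp.EM (P x); first by exists 0.
  by have [y yE] := eU nPx; exists y.
split=> [[l [lU lE]]|[l lE]].
  exists [seq z.1 * v z.2 | z <- l] => x.
  have [//|z zl /loc_eqE /= E] := lE (x, 1); have /= nPz := lU z zl.
  exists (z.1 * v z.2); first by apply/mapP; exists z => //; apply/InP.
  have -> : e * (x - z.1 * v z.2) = (e - e * z.2 * v z.2) * x
     + v z.2 * (e * (x * z.2 - z.1 * 1)) by ring.
  by rewrite E vE // subrr mul0r mulr0 addr0.
exists [seq (z, 1) | z <- l]; split.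
  by move=> z /InP /mapP [x _ ->].
move=> [a s] /= nPs; have [z zl E] := lE (a * v s); exists (z, 1).
  by apply/InP/mapP; exists z.
apply/loc_eqE => /=.
have -> : e * (a * 1 - z * s) = (e - e * s * v s) * a + s * (e * (a * v s - z)) by ring.
by rewrite E vE // subrr mul0r mulr0 addr0.
Qed.

Lemma loc_SPIRE : loc_SPIR P <-> ~ loc_field (compl P) /\
  exists2 g, P g & forall x, P x -> exists y, e * x = e * g * y.
Proof.
split=> [[nf [[g s] /= [nPs Pg gen _]]]|[nf [g Pg gen]]]; split=> //.
  exists g => // x Px; have [//|//|[a t] /= nPt /loc_eqE /= E] := gen (x, 1).
  have nPst : ~ P (s * t) by case/PM.
  have [w wE] := eU nPst; exists (w * a).
  have -> : e * x = e * (s * t) * w * x by rewrite wE.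
  have -> : e * (s * t) * w * x = w * (e * (x * (s * t) - g * a * 1)) + e * g * (w * a) by ring.
  by rewrite E mulr0 add0r.
exists (g, 1); split=> //=.
  move=> [a s] /= nPs Pa; have [y yE] := gen a Pa; exists (y, s) => //.
  apply/loc_eqE => /=.
  have -> : e * (a * (1 * s) - g * y * s) = s * (e * a - e * g * y) by ring.
  by rewrite yE subrr mulr0.
have [n gn] : exists n, e * g ^+ n = 0 by case: eP => _ _ H _; apply: H.
by exists n; apply/loc_eqE; rewrite /= mul0r subr0 mulr1.
Qed.

Lemma splits_at_local (B : comNzRingType) (pi : {rmorphism A -> B}) :
  (forall b, exists a, pi a = b) -> (forall a, pi a = 0 <-> e * a = 0) -> local_ring B.
Proof.
move=> pi_surj piE b; have [x <-] := pi_surj b.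
have [Px|nPx] := boolp.EM (P x).
  right; have [n exn] : exists n, e * x ^+ n = 0 by case: eP => _ _ H _; apply: H.
  by exists n; rewrite -rmorphXn; apply/piE.
left; have [y exy] := eU nPx; exists (pi y); apply/eqP.
rewrite -subr_eq0 -rmorphM -(rmorph1 pi) -rmorphB; apply/eqP/piE.
by rewrite mulrBr mulr1 mulrA exy subrr.
Qed.

End LocalizationAtIdempotent.

Lemma FMIR_quotient (A B : comNzRingType) (pi : {rmorphism A -> B}) :
  (forall b, exists a, pi a = b) -> FMIR A -> FMIR B.
Proof.
move=> pi_surj [l lE]; exists (List.map (fun L b => exists2 a, L a & pi a = b) l) => J Ji.
have [L Ll LE] := lE _ (preim_ideal pi Ji).
exists (fun b => exists2 a, L a & pi a = b).
  exact: (List.in_map (fun L b => exists2 a, L a & pi a = b)).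
move=> b; split=> [Jb|[a /LE Ja <-] //]; have [a ab] := pi_surj b.
by exists a => //; apply/LE; rewrite ab.
Qed.

(** The local dichotomy is applied to [A / Ann(e)], which is the factor [eA]: since it is infinite,
    its nilradical is principal. *)
Lemma FMIR_trichotomy (A : comNzRingType) (P : A -> Prop) : FMIR A -> is_prime P ->
  ~ loc_field (compl P) -> ~ loc_finite (compl P) -> loc_infSPIR P.
Proof.
move=> Afm Pp nf nfin; have [e eP _] := prime_splits_at Afm Pp.
split=> //; apply/(loc_SPIRE Pp eP); split=> //.
have [|B [pi [pi_surj piE]]] := quotient_ring (annihilator_ideal e).
  by rewrite mulr1 => e0; case: eP => _ + _ _; rewrite e0; case: Pp => [[]].
have Bloc := splits_at_local eP pi_surj piE.
have nilE x : nilpotent (pi x) <-> P x.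
  split=> [[n]|Px]; first by rewrite -rmorphXn => /piE; apply: splits_at_nil.
  have [n exn] : exists n, e * x ^+ n = 0 by case: eP => _ _ H _; apply: H.
  by exists n; rewrite -rmorphXn; apply/piE.
case: (local_dichotomy (FMIR_quotient pi_surj Afm) Bloc) => [[l lE]|[p np pE]].
  case: nfin; apply/(loc_finiteE Pp eP); have [s sK] := boolp.choice pi_surj.
  exists (map s l) => x; exists (s (pi x)); first exact: map_f.
  by apply/piE; rewrite rmorphB sK subrr.
have [g gp] := pi_surj p; exists g; first by apply/nilE; rewrite gp.
move=> x /nilE /pE [b bE]; have [y yb] := pi_surj b; exists y.
apply/eqP; rewrite -subr_eq0 -mulrA -mulrBr; apply/eqP/piE.
by rewrite rmorphB rmorphM gp yb -bE subrr.
Qed.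

(** * Etale extensions *)

Section RankTwo.
Variables (R S : comNzRingType) (f : {rmorphism R -> S}).

(** In [1 = c1 b1 + c2 b2] one coefficient is a unit, as otherwise [1] would be nilpotent; the
    corresponding generator is exchanged for [1]. *)
Lemma generated_by_two (b1 b2 : S) : local_ring R ->
  (forall s, exists c1 c2, s = f c1 * b1 + f c2 * b2) ->
  exists x, forall s, exists a b, s = f a + f b * x.
Proof.
move=> Rloc gen; wlog [c1 [c2 [y cy oneE]]] : b1 b2 gen / exists c1 c2, exists2 y,
    c1 * y = 1 & 1 = f c1 * b1 + f c2 * b2.
  move=> W; have [c1 [c2 E]] := gen 1.
  case: (Rloc c1) => [[y cy]|[n1 n1E]]; first by apply: (W b1 b2) => //; exists c1, c2, y.
  case: (Rloc c2) => [[y cy]|[n2 n2E]].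
    apply: (W b2 b1); last by exists c2, c1, y => //; rewrite addrC.
    by move=> s; have [d1 [d2 ->]] := gen s; exists d2, d1; rewrite addrC.
  case: (@not_nilpotent1 S); rewrite E; have [_ [nD nM]] := nilpotent_ideal S.
  by apply: nD; rewrite mulrC; apply: nM; [exists n1|exists n2];
    rewrite -rmorphXn ?n1E ?n2E rmorph0.
exists b2 => s; have [a [b ->]] := gen s; exists (a * y), (b - a * y * c2).
have -> : b1 = f y * (1 - f c2 * b2).
  by rewrite {1}oneE addrK mulrA -rmorphM [y * c1]mulrC cy rmorph1 mul1r.
by rewrite rmorphB !rmorphM; ring.
Qed.

Lemma rank_two_FIP (x : S) : FMIR R ->
  (forall s, exists a b, s = f a + f b * x) -> FIP f.
Proof.
move=> [l lE] gen.
exists (List.map (fun (I : R -> Prop) s => exists a b, I b /\ s = f a + f b * x) l) => T Talg.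
have [Tf [TD [TN TM]]] := Talg.
have [|I Il IE] := lE (fun r => T (f r * x)).
  split; first by rewrite rmorph0 mul0r -(rmorph0 f).
  split=> [r r' Tr Tr'|a r Tr]; first by rewrite rmorphD mulrDl; apply: TD.
  by rewrite rmorphM -mulrA; apply: TM.
exists (fun s => exists a b, I b /\ s = f a + f b * x).
  exact: (List.in_map (fun (I : R -> Prop) s => exists a b, I b /\ s = f a + f b * x)).
move=> s; split=> [Ts|[a [b [/IE Tb ->]]]]; last by apply: TD.
have [a [b sE]] := gen s; exists a, b; split=> //; apply/IE.
by rewrite -(addKr (f a) (f b * x)) -sE; apply: TD => //; apply: TN.
Qed.

End RankTwo.

Section Support.
Variables (R S : comNzRingType) (f : {rmorphism R -> S}) (P : R -> Prop) (e : R).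
Hypotheses (Pp : is_prime P) (eP : splits_at P e).

(** Outside the support [1] generates the factor of [S]; the dummy generator [0] gives this case the
    shape of rank two. *)
Lemma not_in_Supp_generated : ~ in_Supp f P ->
  forall s, exists c1 c2, f e * s = f e * (f c1 * 1 + f c2 * 0).
Proof.
move=> nS s.
have [u [nPu [r usr]]] : exists u, ~ P u /\ exists r, f u * s = f r.
  apply: boolp.contrapT => H; apply: nS; exists s => u nPu ur.
  by apply: H; exists u.
have [y euy] : exists y, e * u * y = e by case: eP => _ _ _; apply.
exists (y * r), 0; rewrite mulr0 addr0 mulr1 -{1}euy.
by rewrite !rmorphM -usr; ring.
Qed.

(** Denominators become units after multiplication by [f e], so the numerators of a basis generate;
    ranks below two are padded with [0]. *)
Lemma free_rank_le2_generated : free_rank_le2 f P ->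
  exists b1 b2, forall s, exists c1 c2, f e * s = f e * (f c1 * b1 + f c2 * b2).
Proof.
case=> n [b [len bU gen _]].
suff H : forall s, exists c : 'I_n -> R, f e * s = f e * \sum_i f (c i) * (b i).1.
  case: n len b bU gen H => [|[|[|//]]] _ b bU gen H.
  - exists 0, 0 => s; have [c ->] := H s; exists 0, 0.
    by rewrite big_ord0; ring.
  - exists (b 0).1, 0 => s; have [c ->] := H s; exists (c 0), 0.
    by rewrite big_ord1; ring.
  - pose i1 : 'I_2 := lift ord0 ord0.
    exists (b ord0).1, (b i1).1 => s; have [c ->] := H s; exists (c ord0), (c i1).
    by rewrite big_ord_recl big_ord1.
pose M s := exists c : 'I_n -> R, f e * s = f e * \sum_i f (c i) * (b i).1.
have MD x y : M x -> M y -> M (x + y).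
  move=> [c cE] [d dE]; exists (fun i => c i + d i); rewrite mulrDr cE dE -mulrDr -big_split.
  by congr (_ * _); apply: eq_bigr => i _; rewrite rmorphD mulrDl.
have MM r x : M x -> M (f r * x).
  move=> [c cE]; exists (fun i => r * c i); rewrite mulrCA cE mulrCA; congr (_ * _).
  by rewrite mulr_sumr; apply: eq_bigr => i _; rewrite rmorphM mulrA.
have M0 : M 0.
  by exists (fun=> 0); rewrite big1 // => i _; rewrite rmorph0 mul0r.
have Mb i : M (b i).1.
  exists (fun j => (j == i)%:R); rewrite (bigD1 i) //= eqxx rmorph1 mul1r big1 ?addr0 //.
  by move=> j /negbTE ->; rewrite rmorph0 mul0r.
have PM x y : ~ P x -> ~ P y -> ~ P (x * y) by case: Pp => _ [_ PM] nx ny /PM [].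
move=> s; have [|c [cU]] := gen (s, 1).
  by exists 1; rewrite ?rmorph1 //; case: Pp => _ [].
set z := \big[_/_]_(i < n) _.
have [[v nPv z2] Mz] : imgU f P z.2 /\ M z.1.
  rewrite /z; apply: (big_ind (fun z : S * S => imgU f P z.2 /\ M z.1)).
  - by split=> //; exists 1; rewrite ?rmorph1 //; case: Pp => _ [].
  - move=> [x1 x2] [y1 y2] /= [[v nPv ->] Mx] [[w nPw ->] My]; split.
      by exists (v * w); rewrite ?rmorphM //; apply: PM.
    by apply: MD; rewrite mulrC; apply: MM.
  - move=> i _ /=; split; last exact: MM.
    have [v nPv ->] := bU i; exists ((c i).2 * v); rewrite ?rmorphM //.
    by apply: PM.
case=> _ [u nPu ->] /=; rewrite z2 mulr1 => E.
have [y uvy] : exists y, e * (u * v) * y = e by case: eP => _ _ _; apply; apply: PM.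
have -> : f e * s = f e * (f (u * y) * z.1).
  rewrite -{1}uvy !rmorphM.
  have -> : f e * (f u * f v) * f y * s = f e * f y * (f u * (s * f v - z.1))
     + f e * (f u * f y * z.1) by ring.
  by rewrite E mulr0 add0r.
exact: MM.
Qed.

End Support.

Section Corner.
Variables (R S : comNzRingType) (f : {rmorphism R -> S}).
Hypotheses (Sft : finite_type f) (Ssep : separable f) (Rfm : FMIR R) (finj : injective f).

Lemma corner (e : R) : e <> 0 ->
  exists (R' S' : comNzRingType) (p : {rmorphism R -> R'}) (q : {rmorphism S -> S'})
    (f' : {rmorphism R' -> S'}),
  [/\ (forall y, exists x, p x = y) /\ (forall x, p x = 0 <-> e * x = 0),
      (forall y, exists x, q x = y) /\ (forall x, q x = 0 <-> f e * x = 0),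
      forall x, f' (p x) = q (f x) & [/\ finite_type f', separable f' & FMIR R']].
Proof.
move=> ne; have [|R' [p [p_surj pE]]] := quotient_ring (annihilator_ideal e).
  by rewrite mulr1.
have [|S' [q [q_surj qE]]] := quotient_ring (annihilator_ideal (f e)).
  by rewrite mulr1 -(rmorph0 f) => /finj.
have [|f' f'E] := @quotient_map R S R' S' f p q p_surj.
  by move=> x /pE ex; apply/qE; rewrite -rmorphM ex rmorph0.
exists R', S', p, q, f'; split=> //; split.
- exact: finite_type_quotient q_surj f'E Sft.
- exact: separable_quotient q_surj f'E Ssep.
- exact: FMIR_quotient p_surj Rfm.
Qed.

Lemma extension_FMIR : FMIR S.
Proof.
pose Pr (e : R) := finitely_many (fun L : S -> Prop => is_ideal L /\ L (1 - f e)).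
suff Pr1 : Pr 1.
  apply: finitely_many_sub Pr1 => L Li; split=> //.
  by rewrite rmorph1 subrr; case: Li.
apply: idem_ind; rewrite ?mulr1 //.
- exact: FMIR_pi_regular.
- exact: FMIR_idem_noetherian.
- move=> e e' ee e'e' _; rewrite /Pr rmorphD.
  by apply: finitely_many_ideals_glue; rewrite -rmorphM ?ee ?e'e'.
- exists [:: fun=> True] => L [Li L1]; exists (fun=> True); first by left.
  move=> x; split=> // _; rewrite rmorph0 subr0 in L1.
  by rewrite -[x]mulr1; case: Li => _ [_]; apply.
move=> e eprim; have [ee ne _] := eprim.
have [R' [S' [p [q [f' [[p_surj pE] [q_surj qE] f'E [S'ft S'sep R'fm]]]]]]] := corner ne.
have R'loc := splits_at_local (primitive_splits_at eprim) p_surj pE.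
apply: (finitely_many_image (pi := q)) (local_FMIR S'sep R'fm R'loc)
  => [L [[L0 [LD LM]] L1]|L [Li L1] x y Lx xy].
  split; first by exists 0; rewrite ?rmorph0.
  split=> [_ _ [x Lx <-] [y Ly <-]|a _ [x Lx <-]].
    by exists (x + y); rewrite ?rmorphD //; apply: LD.
  by have [a' <-] := q_surj a; exists (a' * x); rewrite ?rmorphM //; apply: LM.
have [L0 [LD LM]] := Li; have -> : y = x + (y - x) * (1 - f e).
  have /qE : q (y - x) = 0 by rewrite rmorphB xy subrr.
  by move=> E; apply/eqP; rewrite -subr_eq0 -[X in _ == X]E; apply/eqP; ring.
by apply: LD => //; apply: LM.
Qed.

Lemma extension_FIP :
  (forall P : R -> Prop, is_prime P -> in_Supp f P -> loc_infSPIR P -> free_rank_le2 f P) ->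
  FIP f.
Proof.
move=> rk2.
(* Subalgebras containing [(1 - f e) S] correspond to subalgebras of the factor [f(e) S] over
   [eR]. *)
pose Pr (e : R) := finitely_many (fun T : S -> Prop =>
  is_subalg f T /\ forall x, T ((1 - f e) * x)).
suff Pr1 : Pr 1.
  apply: finitely_many_sub Pr1 => T Talg; split=> // x.
  by rewrite rmorph1 subrr mul0r -(rmorph0 f); case: Talg.
apply: idem_ind; rewrite ?mulr1 //.
- exact: FMIR_pi_regular.
- exact: FMIR_idem_noetherian.
- move=> e e' ee e'e' _.
  apply: (finitely_many_glue (u1 := fun x => f e * x) (u2 := fun x => f e' * x)).
    move=> T [[Tf [TD [TN TM]]] T1].
    have alg c : c * c = c -> is_subalg f (fun x => T (f c * x)) /\
        forall x, T (f c * ((1 - f c) * x)).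
      move=> cc; have fcc : f c * f c = f c by rewrite -rmorphM cc.
      split; last by move=> x; rewrite mulrA mulrBr mulr1 fcc subrr mul0r -(rmorph0 f).
      split; first by move=> r; rewrite -rmorphM.
      split; first by move=> x y; rewrite mulrDr; apply: TD.
      split; first by move=> x; rewrite mulrN; apply: TN.
      by move=> x y Tx Ty; rewrite -fcc mulrACA; apply: TM.
    by split; apply: alg.
  move=> T [[Tf [TD [TN TM]]] T1] x; split=> [Tx|[Tex Te'x]]; first by split; apply: TM.
  have -> : x = (1 - f (e + e')) * x + (f e * x + f e' * x) by rewrite rmorphD; ring.
  by apply: (TD) => //; apply: TD.
- exists [:: fun=> True] => T [_ T1]; exists (fun=> True); first by left.
  by move=> x; split=> // _; rewrite -[x]mul1r -[1]subr0 -(rmorph0 f).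
move=> e eprim; have [ee ne _] := eprim.
have [R' [S' [p [q [f' [[p_surj pE] [q_surj qE] f'E [S'ft S'sep R'fm]]]]]]] := corner ne.
have eP := primitive_splits_at eprim; have Pp := primitive_prime_prime eprim.
set P := primitive_prime e in eP Pp.
have R'loc := splits_at_local eP p_surj pE.
suff FIP' : FIP f'.
  apply: (finitely_many_image (pi := q)) FIP'
    => [T [[Tf [TD [TN TM]]] T1]|T [[Tf [TD [TN TM]]] T1] x y Tx xy].
    split; first by move=> r'; have [r <-] := p_surj r'; rewrite f'E; exists (f r).
    split; first by move=> _ _ [x Tx <-] [y Ty <-]; exists (x + y); rewrite ?rmorphD //; apply: TD.
    split; first by move=> _ [x Tx <-]; exists (- x); rewrite ?rmorphN //; apply: TN.
    by move=> _ _ [x Tx <-] [y Ty <-]; exists (x * y); rewrite ?rmorphM //; apply: TM.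
  have -> : y = x + (1 - f e) * (y - x).
    have /qE : q (y - x) = 0 by rewrite rmorphB xy subrr.
    by move=> E; apply/eqP; rewrite -subr_eq0 -[X in _ == X]E; apply/eqP; ring.
  exact: TD.
have nilE x : nilpotent (p x) <-> P x.
  split=> [[n]|Px]; first by rewrite -rmorphXn => /pE; apply: splits_at_nil.
  have [n exn] : exists n, e * x ^+ n = 0 by case: eP => _ _ H _; apply: H.
  by exists n; rewrite -rmorphXn; apply/pE.
have [fin|nfin] := boolp.EM (loc_finite (compl P)).
  have /(loc_finiteE Pp eP) [l lE] := fin.
  have [|l' l'E] := local_finite S'sep R'fm R'loc; last exact: finitely_many_finite l'E.
  exists (map p l) => x; have [r <-] := p_surj x; have [z zl /pE] := lE r.
  by rewrite rmorphB => /eqP; rewrite subr_eq0 => /eqP ->; apply: map_f.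
have [fld|nfld] := boolp.EM (loc_field (compl P)).
  apply: separable_FIP => // x; have [r <-] := p_surj x.
  case: (R'loc (p r)) => [|/nilE Pr']; first by right.
  by left; apply/pE; have /(loc_fieldE Pp eP) := fld; apply.
(* The local base is now neither finite nor a field, hence an infinite SPIR. *)
have [b1 [b2 gen]] : exists b1 b2, forall s, exists c1 c2,
    f e * s = f e * (f c1 * b1 + f c2 * b2).
  have [sup|nsup] := boolp.EM (in_Supp f P); last by exists 1, 0; apply: not_in_Supp_generated nsup.
  by apply: (free_rank_le2_generated Pp eP); apply: rk2 => //; apply: FMIR_trichotomy.
have [|x xE] := @generated_by_two R' S' f' (q b1) (q b2) R'loc; last exact: rank_two_FIP xE.
move=> s'; have [s <-] := q_surj s'; have [c1 [c2 E]] := gen s; exists (p c1), (p c2).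
rewrite !f'E -!rmorphM -rmorphD; apply/eqP; rewrite -subr_eq0 -rmorphB; apply/eqP/qE.
by rewrite mulrBr E subrr.
Qed.

End Corner.

(** * Comparison of the local rings [S_Q] and [R_P] *)

Section Fibres.
Variables (R S : comNzRingType) (f : {rmorphism R -> S}).
Hypotheses (Sft : finite_type f) (Ssep : separable f) (Sflat : flat_alg f).
Hypotheses (Rfm : FMIR R) (Sfm : FMIR S) (finj : injective f).
Variable Q : S -> Prop.
Hypothesis Qp : is_prime Q.

Let P := fun r : R => Q (f r).

Lemma contraction_prime : is_prime P.
Proof.
have [Qi [Q1 QM]] := Qp; split; first exact: preim_ideal.
by rewrite /P rmorph1; split=> // x y; rewrite rmorphM; apply: QM.
Qed.

Let Pp := contraction_prime.

(** Injectivity of [R_P -> S_Q]. The equational criterion for the single relation [f r * q = 0]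
    gives [q = sum a_j y_j] with [r a_j = 0]; as [q] is outside [Q], some [a_j] is outside [P] and
    so a unit in the factor. *)
Lemma flat_localization_inj (e : R) (q : S) (r : R) :
  splits_at P e -> ~ Q q -> q * f r = 0 -> e * r = 0.
Proof.
move=> eP nQq qr; have [Qi [Q1 QM]] := Qp; have [Q0 [QD QI]] := Qi.
have [|m [a [y [/(_ ord0) qE ra]]]] := Sflat (n := 1) (r := fun=> r) (x := fun=> q).
  by rewrite big_ord1 mulrC.
have [j nPj] : exists j, ~ P (a ord0 j).
  apply: boolp.contrapT => H; apply: nQq; rewrite qE; apply: ideal_sum => // j.
  rewrite mulrC; apply: QI; apply: boolp.contrapT => nP; apply: H; by exists j.
have := ra j; rewrite big_ord1 => raj.
have [z eaz] : exists z, e * a ord0 j * z = e by case: eP => _ _ _; apply.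
by rewrite -eaz -mulrA [z * r]mulrC mulrA -[e * _ * r]mulrA [a _ _ * r]mulrC raj mulr0 mul0r.
Qed.

(** This yields [Q S_Q = P S_Q]: [q z] is nilpotent, and the fibre [S / P S], being semisimple, is
    reduced. *)
Lemma fibre_reduced (q : S) (z : S) : splits_at Q q -> Q z -> extended f P (q * z).
Proof.
move=> qQ Qz; have [Qi [Q1 QM]] := Qp; have [e eP _] := prime_splits_at Rfm Pp.
have [Pi [P1 PM]] := Pp; have [P0 _] := Pi.
have [||B [pi [_ piE Bss _]]] := residue_algebra Ssep Pi.
- move=> x; have [Px|nPx] := boolp.EM (P x); [by left|right].
  have [ee nPe _ eU] := eP; have [y exy] := eU x nPx; exists y.
  by case: (PM e (x * y - 1)) => //; rewrite mulrBr mulr1 mulrA exy subrr.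
- by move=> E; apply: Q1; apply: (E Q) => // _ [r Pr ->].
apply/piE; have [qq _ qn _] := qQ; have [n qzn] := qn z Qz.
apply: (@regular_reduced _ (semisimple_regular Bss) _ n.+1).
rewrite -rmorphXn exprMn_comm; last exact: mulrC.
have -> : q ^+ n.+1 * z ^+ n.+1 = q * z ^+ n * (q ^+ n * z) by rewrite !exprS; ring.
by rewrite qzn mul0r rmorph0.
Qed.

Lemma fibre_types :
  [/\ loc_field (compl Q) <-> loc_field (compl P),
      loc_finite (compl Q) <-> loc_finite (compl P) &
      loc_infSPIR Q <-> loc_infSPIR P].
Proof.
have [e eP _] := prime_splits_at Rfm Pp; have [q qQ minq] := prime_splits_at Sfm Qp.
have [ee nPe _ _] := eP; have [qq nQq _ _] := qQ.
have [Qi [Q1 QM]] := Qp.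
(* [q f(e)] is an idempotent outside [Q] and below [q], so by minimality the factor [qS] lies inside
   [f(e)S]. *)
have qe : q * f e = q.
  apply: minq; first by rewrite mulrACA -rmorphM ee qq.
    by case/QM.
  by rewrite mulrAC qq.
have inj r : q * f r = 0 -> e * r = 0 by apply: flat_localization_inj.
have fieldE : loc_field (compl Q) <-> loc_field (compl P).
  rewrite (loc_fieldE Qp qQ) (loc_fieldE Pp eP); split=> H.
    by move=> r Pr; apply/inj/H.
  move=> z Qz; rewrite -qq -mulrA.
  apply: (fibre_reduced qQ Qz (I := fun w => q * w = 0)); first exact: annihilator_ideal.
  by move=> _ [r Pr ->]; rewrite -qe -mulrA -rmorphM H // rmorph0 mulr0.
have finE : loc_finite (compl Q) <-> loc_finite (compl P).
  rewrite (loc_finiteE Qp qQ) (loc_finiteE Pp eP); split=> [[l lE]|[l lE]].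
    (* Descent of finiteness along the injection: a representative in [S] is replaced by an element
       of [R] with the same class if there is one, and by [0] otherwise. *)
    have /boolp.choice [v vE] : forall z, exists r, (exists r', q * (f r' - z) = 0) ->
        q * (f r - z) = 0.
      move=> z; have [[r rE]|nr] := boolp.EM (exists r', q * (f r' - z) = 0).
        by exists r.
      by exists 0.
    exists (map v l) => r; have [z zl zE] := lE (f r); exists (v z); first exact: map_f.
    apply: inj; have vz : q * (f (v z) - z) = 0 by apply: vE; exists r.
    have -> : q * f (r - v z) = q * (f r - z) - q * (f (v z) - z) by rewrite rmorphB; ring.
    by rewrite zE vz subrr.
  have ne : e <> 0 by move=> e0; apply: nPe; rewrite /P e0 rmorph0; case: Qi.
  have [R' [S' [p [pi [f' [[p_surj pE] [pi_surj piE] f'E [S'ft S'sep R'fm]]]]]]] :=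
    corner Sft Ssep Rfm finj ne.
  have R'loc := splits_at_local eP p_surj pE.
  have [|l' l'E] := local_finite S'sep R'fm R'loc.
    exists (map p l) => x; have [r <-] := p_surj x; have [z zl /pE] := lE r.
    by rewrite rmorphB => /eqP; rewrite subr_eq0 => /eqP ->; apply: map_f.
  have [s sK] := boolp.choice pi_surj; exists (map s l') => z.
  exists (s (pi z)); first exact: map_f.
  have /piE E : pi (z - s (pi z)) = 0 by rewrite rmorphB sK subrr.
  by rewrite -qe -mulrA E mulr0.
split=> //; split=> [[[nf _] nfin]|[SP nfin]].
  by apply: FMIR_trichotomy => //; rewrite -?fieldE -?finE.
split; last by rewrite finE.
have /(loc_SPIRE Pp eP) [nf [g Pg gen]] := SP.
apply/(loc_SPIRE Qp qQ); split; first by rewrite fieldE.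
exists (f g) => // z Qz.
have [||y yE] := fibre_reduced qQ Qz (I := fun w => exists y, q * w = q * f g * y).
- split; first by exists 0; rewrite !mulr0.
  split=> [x y [x' xE] [y' yE]|a x [x' xE]]; first by exists (x' + y'); rewrite !mulrDr xE yE.
  by exists (a * x'); rewrite mulrCA xE; ring.
- move=> _ [r Pr ->]; have [y yE] := gen r Pr; exists (f y).
  by rewrite -qe -!mulrA -!rmorphM mulrA -yE.
by exists y; rewrite -yE mulrA qq.
Qed.

End Fibres.

Theorem theorem3p10 (R S : comNzRingType) (f : {rmorphism R -> S}) :
  injective f -> etale f -> FMIR R ->
  (FMIR S /\
   forall Q : S -> Prop, is_prime Q ->
     let P := fun r : R => Q (f r) in
     [/\ loc_field (compl Q) <-> loc_field (compl P),
         loc_finite (compl Q) <-> loc_finite (compl P) &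
         loc_infSPIR Q <-> loc_infSPIR P])
  /\
  ((forall P : R -> Prop, is_prime P -> in_Supp f P -> loc_infSPIR P ->
      free_rank_le2 f P) -> FIP f).
Proof.
move=> finj [Sflat Sfp Sunr] Rfm.
have Sft : finite_type f by case: Sfp => n [h [k [g [gen _]]]]; exists n, h.
have Ssep := unramified_separable Sft Sunr.
have Sfm := extension_FMIR Sft Ssep Rfm finj.
split; last exact: extension_FIP.
by split=> // Q Qp; apply: fibre_types.
Qed.
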